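(* Let $\mu>0$, $1<p<+\infty$ and $f\in L^p([0,1])$. Then for every sufficiently large $n\in\mathbb{N}$, $$\|\mathscr{L}_n^K f-f\|_p\le\frac{\ln(2+\mu)}{\ln(1+\mu)}(K_\mu+1)\,\widetilde{\mathcal{K}}(f,\Gamma_n)_p,$$ where $K_\mu:=1+\frac{1}{1+\mu}$, $\Gamma_n:=2^{\frac{p-1}{p}}C_{p,\mu}\frac{\ln(2+\mu)}{\ln(1+\mu)}(K_\mu+1)^{-1}T_n$, $T_n:=\frac{1}{2(n+1)}+\frac{\sqrt2}{\sqrt{n+1}}+\gamma_n$, $\gamma_n:=\max_{x\in[0,1]}|a_{n+1}(x)-x|$, and $C_{p,\mu}:=\max\left\{\frac{1}{(1+\mu)\ln(1+\mu)},\,C_p\right\}$.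
   Context: Fix $\mu>0$. Let $\ln_\mu(x):=\ln(1+\mu+x)$ for $x\in[0,1]$, and for $f:[0,1]\to\mathbb{R}$ let $f_\mu(x):=f(x)/\ln_\mu(x)$. Let $p_{n,k}(y):=\binom{n}{k}y^k(1-y)^{n-k}$ and $a_{n+1}(x):=\dfrac{\ln\left(1+\frac{x}{(n+1)(1+\mu)}\right)}{\ln\left(1+\frac{1}{(n+1)(1+\mu)}\right)}$, $x\in[0,1]$. For $n\in\mathbb{N}$ define $\mathscr{L}_n^K f(x):=\ln_\mu(x)\sum_{k=0}^n p_{n,k}(a_{n+1}(x))\,(n+1)\int_{k/(n+1)}^{(k+1)/(n+1)} f_\mu(t)\,dt$, $x\in[0,1]$. $W^{1,p}([0,1])$ is the Sobolev space of absolutely continuous $g:[0,1]\to\mathbb{R}$ with $g'\in L^p([0,1])$, normed by $\|g\|_{W^{1,p}}:=\|g\|_p+\|g'\|_p$, and $\widetilde{\mathcal{K}}(f,t)_p:=\inf_{g\in W^{1,p}([0,1])}\{\|f-g\|_p+t\|g\|_{W^{1,p}}\}$ for $t>0$. The Hardy–Littlewood maximal function is $M(f;x):=\sup_{0<t\le1,\,t\ne x}\frac{1}{t-x}\int_x^t|f(u)|\,du$, and $C_p>0$ denotes a constant depending only on $p$ such that $\|M(f;\cdot)\|_p\le C_p\|f\|_p$ for all $f\in L^p([0,1])$. *)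

(* Defs.v *)
From HB Require Import structures.
From mathcomp Require Import all_boot all_order all_algebra.
From mathcomp Require Import all_classical all_reals all_analysis.
Set Implicit Arguments. Unset Strict Implicit. Unset Printing Implicit Defensive.
Import Order.TTheory GRing.Theory Num.Theory.
Import numFieldNormedType.Exports.
Local Open Scope classical_set_scope.
Local Open Scope ring_scope.

Section Defs.
Context {R : realType}.
Notation mu := (@lebesgue_measure R).
Local Notation I01 := (`[(0:R), (1:R)]%classic : set R).

Definition lnmu (m x : R) : R := ln (1 + m + x).

Definition fmu (m : R) (f : R -> R) (x : R) : R := f x / lnmu m x.

Definition bern (n k : nat) (y : R) : R := 'C(n, k)%:R * y ^+ k * (1 - y) ^+ (n - k).

Definition a_next (m : R) (n : nat) (x : R) : R :=
  ln (1 + x / (n.+1%:R * (1 + m))) / ln (1 + 1 / (n.+1%:R * (1 + m))).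

Definition LK (m : R) (n : nat) (f : R -> R) (x : R) : R :=
  lnmu m x * \sum_(k < n.+1)
     bern n k (a_next m n x) * (n.+1%:R *
       Rintegral mu `[k%:R / n.+1%:R, k.+1%:R / n.+1%:R] (fmu m f)).

Definition Lpnorm01 (p : R) (F : R -> \bar R) : \bar R :=
  ((\int[mu]_(x in I01) (`|F x| `^ p)) `^ p^-1)%E.

Definition pnorm (p : R) (f : R -> R) : \bar R := Lpnorm01 p (fun x => (f x)%:E).

Definition inLp (p : R) (f : R -> R) : Prop :=
  measurable_fun I01 f /\ (\int[mu]_(x in I01) (`|f x| `^ p)%:E < +oo)%E.

Definition abs_cont01 (g : R -> R) : Prop :=
  forall e : R, 0 < e -> exists2 d : R, 0 < d &
    forall (N : nat) (a b : 'I_N -> R),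
      (forall i, 0 <= a i /\ a i <= b i /\ b i <= 1) ->
      (forall i j, i != j -> b i <= a j \/ b j <= a i) ->
      \sum_(i < N) (b i - a i) < d ->
      \sum_(i < N) `|g (b i) - g (a i)| < e.

Definition W1p (p : R) (g : R -> R) : Prop :=
  abs_cont01 g /\ inLp p (derive1 g).

Definition W1p_norm (p : R) (g : R -> R) : \bar R := (pnorm p g + pnorm p (derive1 g))%E.

Definition Kfun (p : R) (f : R -> R) (t : R) : \bar R :=
  ereal_inf [set (pnorm p (fun x => f x - g x)%R + t%:E * W1p_norm p g)%E | g in W1p p].

(* Hardy-Littlewood maximal function M(f;x) ; (1/(t-x)) \int_x^t |f| written
   with the orientation made explicit *)
Definition maxfun (f : R -> R) (x : R) : \bar R :=
  ereal_sup [set ((`|t - x|)^-1%:E *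
                  \int[mu]_(u in `[Order.min x t, Order.max x t]) (`|f u|)%:E)%E
            | t in [set t : R | 0 < t <= 1 /\ t != x]].

Definition maximal_const (p Cp : R) : Prop :=
  0 < Cp /\ forall f, inLp p f -> (Lpnorm01 p (maxfun f) <= Cp%:E * pnorm p f)%E.

Definition Kmu (m : R) : R := 1 + 1 / (1 + m).

Definition gamma_n (m : R) (n : nat) : R :=
  sup [set `|a_next m n x - x| | x in I01].

Definition T_n (m : R) (n : nat) : R :=
  1 / (2 * n.+1%:R) + Num.sqrt 2 / Num.sqrt n.+1%:R + gamma_n m n.

Definition Cpmu (p Cp m : R) : R := Num.max (1 / ((1 + m) * ln (1 + m))) Cp.

Definition Gamma_n (p Cp m : R) (n : nat) : R :=
  powR 2 ((p - 1) / p) * Cpmu p Cp m * (ln (2 + m) / ln (1 + m))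
    * (Kmu m + 1)^-1 * T_n m n.

End Defs.

(* Main.v *)
Require Import Defs.
From HB Require Import structures.
From mathcomp Require Import all_boot all_order all_algebra.
From mathcomp Require Import all_classical all_reals all_analysis.
From mathcomp Require Import measurable_realfun ring lra.
Set Implicit Arguments. Unset Strict Implicit. Unset Printing Implicit Defensive.
Import Order.TTheory GRing.Theory Num.Theory.
Import numFieldNormedType.Exports.
Local Open Scope classical_set_scope.
Local Open Scope ring_scope.

(** For [g] in W^{1,p}, split [L f - f] as [L (f - g) + (L g - g) + (g - f)].
    Jensen's inequality and the substitution [y = a_{n+1} x], whose inverse has
    derivative at most [Kmu m], bound the norm of [L (f - g)] by
    [ln (2 + m) / ln (1 + m) * Kmu m] times that of [f - g].
    An absolutely continuous function is a.e. differentiable and is the integral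
    of its derivative: by Radon-Nikodym applied to the Lebesgue-Stieltjes
    measures of its total variation [V] and of [V - g], and by Lebesgue
    differentiation. Hence [|g_mu t - g_mu x| <= |t - x| M (g_mu'; x)], so that
    [|L g - g|] is at most [M (g_mu'; x)] times the mean of [|t - x|], which is
    [O (1 / sqrt n)] by the variance of the Bernstein weights.
    When [m] is small, [1 / ((1 + m) ln (1 + m))] may exceed
    [ln (2 + m) / ln (1 + m)], but by a factor less than 2; this is absorbed by
    the mean of [|t - x|] being at most [T_n / 2] for large [n]. *)

(** * Absolutely continuous functions *)

(** The Sobolev norm uses the pointwise derivative [derive1 g], which says nothing at points where
    [g] is not differentiable. That increments of [g] are controlled by this derivative must
    therefore be extracted from the epsilon-delta definition of absolute continuity. Monotone
    functions are sought on the way because only they define positive measures. Budget of constants,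
    with [rho = ln (2 + m) / ln (1 + m)]: [L (f - g)] costs [rho * Kmu m] and [g - f] costs 1, at
    most [rho], which together explain the factor [Kmu m + 1]. For [L g - g] a factor [rho] comes
    from differentiating [g / lnmu m] and another from multiplying back by [lnmu m], so that
    [rho ^+ 2] appears on both sides of the final comparison. *)

(** Frees the family from ordinal indices: the pieces of several partitions are indexed by pairs of
    an interval and one of its pieces. *)
Lemma abs_cont01_finType (R : realType) (g : R -> R) : abs_cont01 g ->
  forall e, 0 < e -> exists2 d : R, 0 < d &
    forall (I : finType) (a b : I -> R),
      (forall i, 0 <= a i /\ a i <= b i /\ b i <= 1) ->
      (forall i j, i != j -> b i <= a j \/ b j <= a i) ->
      \sum_i (b i - a i) < d -> \sum_i `|g (b i) - g (a i)| < e.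
Proof.
move=> acg e e0; have [d d0 H] := acg e e0.
exists d => // I a b ab01 abdis.
have reidx (F : I -> R) : \sum_i F i = \sum_(i < #|I|) F (enum_val i).
  by rewrite -big_enum_val/=; apply: eq_bigl => i; rewrite inE.
rewrite !reidx; apply: (H _ (fun i => a (enum_val i)) (fun i => b (enum_val i))).
- by move=> i; exact: ab01.
- by move=> i j ij; apply: abdis; rewrite (inj_eq enum_val_inj).
Qed.

Lemma itv_partition_nth_homo (R : realType) (a b : R) (s : seq R) (i j : nat) :
  itv_partition a b s -> (i <= j)%N -> (j <= size s)%N ->
  nth b (a :: s) i <= nth b (a :: s) j.
Proof.
move=> [ps _] ij js; apply: (sorted_leq_nth le_trans lexx b) => //=.
- by apply: sub_path ps => x y /ltW.
- by rewrite inE/= ltnS (leq_trans ij).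
Qed.

(* Partitions of nonoverlapping intervals together form one nonoverlapping
   family, to which absolute continuity applies. *)
Lemma abs_cont01_variation (R : realType) (g : R -> R) : abs_cont01 g ->
  forall e, 0 < e -> exists2 d : R, 0 < d &
    forall (I : finType) (a b : I -> R) (s : I -> seq R),
      (forall i, 0 <= a i /\ a i <= b i /\ b i <= 1) ->
      (forall i j, i != j -> b i <= a j \/ b j <= a i) ->
      (forall i, itv_partition (a i) (b i) (s i)) ->
      \sum_i (b i - a i) < d -> \sum_i variation (a i) (b i) g (s i) < e.
Proof.
move=> acg e e0; have [d d0 H] := abs_cont01_finType acg e0.
exists d => // I a b s ab01 abdis ps.
pose l i k := nth (b i) (a i :: s i) k.
have sumE (f : R -> R) : \sum_i variation (a i) (b i) f (s i) =
    \sum_(p : {i : I & 'I_(size (s i))})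
      `|f (l (tag p) (tagged p).+1) - f (l (tag p) (tagged p))|.
  under eq_bigr do rewrite /variation big_mkord.
  by rewrite sig_big_dep.
(* The total length is read as the variation of the identity, so that [sumE] turns both sides into
   sums over all pieces. *)
have -> : \sum_i (b i - a i) = \sum_i variation (a i) (b i) id (s i).
  apply: eq_bigr => i _; rewrite (nondecreasing_variation _ (ps i))//.
rewrite !sumE => ltd.
apply: (H ({i : I & 'I_(size (s i))} : finType) (fun p => l (tag p) (tagged p))
  (fun p => l (tag p) (tagged p).+1)).
- move=> [i k]/=; have [a0 [aibi b1]] := ab01 i.
  split; last split.
  + by rewrite (le_trans a0)// itv_partition_nth_ge// ltnS ltnW.
  + exact: (itv_partition_nth_homo (ps i)).
  + by rewrite (le_trans _ b1)// itv_partition_nth_le// ltnS.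
- move=> [i k] [j h]/=; have [ij|ij] := eqVneq i j; last first.
    move=> _; case: (abdis _ _ ij) => le_ba; [left|right].
    + apply: le_trans (itv_partition_nth_le _ (ps i)) _; first by rewrite ltnS.
      by apply: le_trans le_ba _; rewrite itv_partition_nth_ge// ltnS ltnW.
    + apply: le_trans (itv_partition_nth_le _ (ps j)) _; first by rewrite ltnS.
      by apply: le_trans le_ba _; rewrite itv_partition_nth_ge// ltnS ltnW.
  subst j; rewrite -tag_eqE /tag_eq/= eqxx/= tagged_asE => kh.
  have [hk|hk] := leqP k.+1 h; [left|right].
    by apply: (itv_partition_nth_homo (ps i)) => //; exact: ltnW.
  apply: (itv_partition_nth_homo (ps i)) => //; last exact: ltnW.
  by move: hk; rewrite ltnS leq_eqVlt eq_sym -[_ == _ :> nat]/(k == h) (negbTE kh).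
- apply: le_lt_trans ltd; apply: ler_sum => p _; exact: ler_norm.
Qed.

(** The unit interval is cut into pieces shorter than the [d] belonging to tolerance 1; each has
    variation at most 1, and variations over adjacent pieces add. *)
Lemma abs_cont01_bounded_variation (R : realType) (g : R -> R) : abs_cont01 g ->
  bounded_variation 0 1 g.
Proof.
move=> acg; have [d d0 H] := abs_cont01_variation acg (@ltr01 R).
have short (a b : R) : 0 <= a -> a <= b -> b <= 1 -> b - a < d ->
    total_variation a b g \is a fin_num.
  move=> a0 ab b1 bad; apply/bounded_variationP => //.
  exists 1 => _ [s abs <-]; apply/ltW.
  have := H 'I_1 (fun=> a) (fun=> b) (fun=> s).
  by rewrite !big_ord1; apply => // i j; rewrite !ord1.
apply/bounded_variationP => //.
have [K dK] : exists K : nat, d^-1 < K.+1%:R.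
  exists (Num.bound d^-1); apply: lt_le_trans (archi_boundP _) _.
    by rewrite invr_ge0 ltW.
  by rewrite ler_nat.
have K0 : (0 : R) < K.+1%:R by rewrite ltr0n.
have kK (k : nat) : (k <= K.+1)%N -> k%:R / K.+1%:R <= 1 :> R.
  by move=> kK; rewrite ler_pdivrMr// mul1r ler_nat.
suff: forall k : nat, (k <= K.+1)%N ->
    total_variation 0 (k%:R / K.+1%:R) g \is a fin_num.
  by move=> /(_ K.+1 (leqnn _)); rewrite divff// gt_eqF.
elim=> [_|k ih kK1]; first by rewrite mul0r total_variationxx.
have k0 : (0 : R) <= k%:R / K.+1%:R by rewrite divr_ge0.
have kk : (k%:R / K.+1%:R : R) <= k.+1%:R / K.+1%:R.
  by rewrite ler_pM2r ?invr_gt0// ler_nat.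
have ihk := ih (ltnW kK1).
rewrite (total_variationD _ k0 kk) fin_numD ihk andTb.
apply: short => //; first exact: kK.
by rewrite -mulrBl -natrB// subSnn mul1r invf_plt.
Qed.

(** Each interval has a partition that nearly exhausts its total variation; [abs_cont01_variation]
    controls all these partitions at once. *)
Lemma abs_cont01_total_variation (R : realType) (g : R -> R) : abs_cont01 g ->
  abs_cont01 (fun x => fine (total_variation 0 x g)).
Proof.
move=> acg e e0; have e20 : 0 < e / 2 by rewrite divr_gt0.
have bvg := abs_cont01_bounded_variation acg.
have finTV (a b : R) : 0 <= a -> a <= b -> b <= 1 ->
    total_variation a b g \is a fin_num.
  move=> a0 ab b1; apply/bounded_variationP => //.
  apply: (bounded_variationr a0 ab).
  by apply: bounded_variationl b1 bvg; exact: le_trans ab.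
have [d d0 H] := abs_cont01_variation acg e20.
exists d => // N a b ab01 abdis sumd.
(* Half of the tolerance is shared among the [N] approximation errors; the successor keeps the
   divisor nonzero when [N] is 0. *)
pose eta := e / 2 / N.+1%:R.
have eta0 : 0 < eta by rewrite divr_gt0.
have /choice[s ps] (i : 'I_N) : exists s, itv_partition (a i) (b i) s /\
    fine (total_variation (a i) (b i) g) - eta <= variation (a i) (b i) g s.
  have [a0 [aibi b1]] := ab01 i.
  have [_ [_ [s abs <-] <-]] := ub_ereal_sup_adherent eta0 (finTV _ _ a0 aibi b1).
  rewrite -/(total_variation (a i) (b i) g) -(fineK (finTV _ _ a0 aibi b1)).
  by rewrite -EFinB lte_fin => /ltW; exists s.
have := H _ a b s ab01 abdis (fun i => (ps i).1) sumd.
move=> lte2; rewrite [ltRHS](splitr e).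
apply: (@le_lt_trans _ _ (\sum_(i < N) variation (a i) (b i) g (s i) + \sum_(i < N) eta)).
  rewrite -big_split/=; apply: ler_sum => i _.
  have [a0 [aibi b1]] := ab01 i.
  rewrite (total_variationD g a0 aibi) fineD ?finTV ?(le_trans aibi)//.
  rewrite addrAC subrr add0r ger0_norm ?fine_ge0 ?total_variation_ge0//.
  by rewrite -lerBlDr; exact: (ps i).2.
apply: ltr_leD => //.
rewrite sumr_const card_ord -[eta *+ N]mulr_natr /eta mulrAC ler_pdivrMr//.
by rewrite ler_pM2l// ler_nat.
Qed.

(** * Lebesgue-Stieltjes measures of absolutely continuous functions *)

Lemma lebesgue_stieltjes_measure_itv_oc (R : realType) (F : cumulative R R) (a b : R) :
  a <= b -> lebesgue_stieltjes_measure F `]a, b]%classic = (F b - F a)%:E.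
Proof.
move=> ab; rewrite /lebesgue_stieltjes_measure /measure_extension.
rewrite measurable_mu_extE; last exact: is_ocitv.
exact: wlength_itv_bnd.
Qed.

Lemma ocitv_sub01 (R : realType) (X : set R) : ocitv X -> X !=set0 ->
  X `<=` `]0, 1] ->
  exists a b : R, [/\ 0 <= a, a < b, b <= 1 & X = `]a, b]%classic].
Proof.
move=> /ocitvP[->[]//|[[a b]/= ab ->] _ X01].
have := X01 b; rewrite /= !in_itv/= ab lexx => /(_ isT)/andP[b0 b1].
exists a, b; split => //; rewrite leNgt; apply/negP => a0.
have := X01 (a / 2); rewrite /= !in_itv/= => /(_ _)/andP[].
  by apply/andP; split; lra.
by move=> ? _; lra.
Qed.

(* The [B j] may overlap: their union is first rewritten, in the ring of sets
   generated by half-open intervals, as a disjoint union of such intervals. *)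
Lemma ocitv_bigcup_small (R : realType) (F : cumulative R R) (e d : R) :
  (forall (N : nat) (a b : 'I_N -> R),
      (forall i, 0 <= a i /\ a i <= b i /\ b i <= 1) ->
      (forall i j, i != j -> b i <= a j \/ b j <= a i) ->
      \sum_(i < N) (b i - a i) < d ->
      \sum_(i < N) `|F (b i) - F (a i)| < e) ->
  forall (B : nat -> set R) (n : nat), (forall j, ocitv (B j)) ->
    (forall j, B j `<=` `]0, 1]) ->
    (lebesgue_measure (\big[setU/set0]_(j < n) B j) < d%:E)%E ->
  (lebesgue_stieltjes_measure F (\big[setU/set0]_(j < n) B j) <= e%:E)%E.
Proof.
move=> acF B n ocB B01.
set D := \big[setU/set0]_(j < n) B j => Dd.
have mD : @measurable _ (SetRing.type (ocitv_type R)) D.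
  apply: bigsetU_measurable => i _.
  exact: (SetRing.measurable_subring (ocB i)).
have [E [finE E0 trivE mE DE]] := SetRing.ring_finite_set mD.
have /finite_seqP[s0 Es0] := finE.
(* Without repetitions, distinct indices give distinct sets, so [X] is disjoint as an indexed
   family. *)
pose s := undup s0.
have Es : E = [set` s] by rewrite Es0; apply/seteqP; split => x /=; rewrite mem_undup.
pose X (i : nat) : set R := nth set0 s i.
have EX (i : 'I_(size s)) : E (X i) by rewrite Es /= /X mem_nth.
have DX : D = \big[setU/set0]_(i < size s) X i.
  rewrite DE Es -bigcup_mkord; apply/seteqP; split => x /=.
    move=> [Y /= Ys Yx]; exists (index Y s); rewrite /= ?index_mem//.
    by rewrite /X nth_index.
  by move=> [i /= si Xx]; exists (X i) => //=; exact: mem_nth.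
have XD (i : 'I_(size s)) : X i `<=` `]0, 1].
  move=> x Xx; have : D x by rewrite DE; exists (X i).
  by rewrite /D -bigcup_mkord => -[j _]; exact: B01.
have /choice[a /choice[b abX]] (i : 'I_(size s)) : exists a b : R,
    [/\ 0 <= a, a < b, b <= 1 & X i = `]a, b]%classic].
  apply: ocitv_sub01; [|exact: E0|exact: XD].
  by apply: mE; rewrite inE.
have trivX : trivIset [set: 'I_(size s)] (fun i => X i).
  move=> i j _ _ /(trivE _ _ (EX i) (EX j)) /eqP.
  by rewrite /X nth_uniq ?undup_uniq// => /eqP/val_inj.
(* Kept general in [G]: it serves for [F] and, with the identity, for the Lebesgue measure that
   bounds the total length. *)
have mX (G : cumulative R R) :
    lebesgue_stieltjes_measure G D = (\sum_(i < size s) (G (b i) - G (a i)))%:E.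
  rewrite DX measure_semi_additive_ord//.
  - rewrite -sumEFin; apply: eq_bigr => i _; have [_ ab _ ->] := abX i.
    exact/lebesgue_stieltjes_measure_itv_oc/ltW.
  - by move=> i; have [_ _ _ ->] := abX i; exact: measurable_itv.
  - apply: bigsetU_measurable => i _; have [_ _ _ ->] := abX i; exact: measurable_itv.
rewrite mX lee_fin; apply: le_trans (ler_sum _ _) (ltW (acF _ a b _ _ _)).
- by move=> i _; exact: ler_norm.
- by move=> i; have [? /ltW ? ? _] := abX i.
- move=> i j ij; have [_ ab _ Xi] := abX i; have [_ ab' _ Xj] := abX j.
  have [|ba] := leP (b i) (a j); first by left.
  have [|ba'] := leP (b j) (a i); first by right.
  (* If neither interval lay beyond the other, the smaller right endpoint would belong to both. *)
  exfalso; move/negP: ij; apply; apply/eqP; apply: trivX => //.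
  exists (Num.min (b i) (b j)); rewrite Xi Xj; split; rewrite /= in_itv/=.
  + by rewrite lt_min ab ba' ge_min lexx.
  + by rewrite lt_min ab' ba ge_min lexx orbT.
- by move: Dd; rewrite /lebesgue_measure mX lte_fin.
Qed.

(* [g \o clamp01] extends [g] to the whole line, as needed to define a
   Lebesgue-Stieltjes measure. *)
Definition clamp01 (R : realType) (x : R) : R := Num.max 0 (Num.min x 1).

Lemma clamp01_itv (R : realType) (x : R) : 0 <= clamp01 x <= 1.
Proof. by rewrite /clamp01 le_max lexx/= ge_max ler01 ge_min lexx orbT. Qed.

Lemma clamp01_id (R : realType) (x : R) : 0 <= x -> x <= 1 -> clamp01 x = x.
Proof. by move=> x0 x1; rewrite /clamp01 (min_idPl x1) (max_idPr x0). Qed.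

Lemma clamp01_nondecreasing (R : realType) : {homo @clamp01 R : x y / x <= y}.
Proof.
move=> x y xy; rewrite /clamp01 ge_max !le_max lexx/=.
by apply/orP; right; rewrite le_min !ge_min xy lexx orbT.
Qed.

Lemma clamp01_lipschitz (R : realType) (x y : R) :
  `|clamp01 x - clamp01 y| <= `|x - y|.
Proof.
wlog xy : x y / x <= y.
  by move=> H; have [/H//|/ltW/H] := leP x y; rewrite distrC (distrC y).
rewrite distrC (distrC x) !ger0_norm ?subr_ge0 ?clamp01_nondecreasing//.
rewrite /clamp01 /Order.max /Order.min.
by case: (ltP x 1) => ?; case: (ltP y 1) => ?; do 2 case: ltP => ?; lra.
Qed.

Lemma abs_cont01_uniform (R : realType) (g : R -> R) : abs_cont01 g ->
  forall e, 0 < e -> exists2 d : R, 0 < d & forall x y, 0 <= x <= 1 -> 0 <= y <= 1 ->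
    `|x - y| < d -> `|g x - g y| < e.
Proof.
move=> acg e e0; have [d d0 H] := acg e e0; exists d => // x y.
wlog xy : x y / x <= y.
  by move=> K; have [/K//|/ltW/K{}K *] := leP x y; rewrite distrC K// distrC.
move=> /andP[x0 x1] /andP[y0 y1]; rewrite distrC ger0_norm ?subr_ge0// => xyd.
have := H 1 (fun=> x) (fun=> y); rewrite !big_ord1 distrC; apply => //.
by move=> i j; rewrite !ord1.
Qed.

Lemma abs_cont01_clamp_continuous (R : realType) (g : R -> R) : abs_cont01 g ->
  continuous (g \o @clamp01 R : R -> R).
Proof.
move=> acg x; apply/cvgrPdist_lt => e e0.
have [d d0 H] := abs_cont01_uniform acg e0.
near=> y; apply: H => /=; [exact: clamp01_itv|exact: clamp01_itv|].
apply: le_lt_trans (clamp01_lipschitz _ _) _.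
by near: y; exact: (@cvgr_dist_lt _ _ _ _ _ (fun y : R => y) _ (@cvg_id _ _) _ d0).
Unshelve. all: by end_near. Qed.

Lemma abs_cont01_measurable (R : realType) (g : R -> R) : abs_cont01 g ->
  measurable_fun (`[(0 : R), (1 : R)]%classic : set R) g.
Proof.
move=> acg; apply: (@eq_measurable_fun _ _ _ _ _ (g \o @clamp01 R)).
  by move=> x; rewrite inE/= in_itv/= => /andP[x0 x1]; rewrite clamp01_id.
apply: measurable_funTS; apply: continuous_measurable_fun.
exact: abs_cont01_clamp_continuous.
Qed.

Section monotone.
Context {R : realType} (G : R -> R).
Hypothesis ndG : forall x y, 0 <= x -> x <= y -> y <= 1 -> G x <= G y.
Hypothesis acG : abs_cont01 G.

Let F : R -> R := G \o @clamp01 R.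

Let ndF : nondecreasing F.
Proof.
move=> x y xy; have /andP[x0 x1] := clamp01_itv x.
by have /andP[y0 y1] := clamp01_itv y; apply: ndG => //; exact: clamp01_nondecreasing.
Qed.

Let rcF : right_continuous F.
Proof. exact/right_continuousW/abs_cont01_clamp_continuous. Qed.

HB.instance Definition _ := isCumulative.Build R _ R F ndF rcF.

Let FE x : 0 <= x -> x <= 1 -> F x = G x.
Proof. by move=> x0 x1; rewrite /F/= clamp01_id. Qed.

Notation nu := (lebesgue_stieltjes_measure F).

(** A null set has covers by half-open intervals of arbitrarily small total length. Absolute
    continuity bounds [nu] of each finite part of such a cover by [e], and continuity from below
    extends this to the whole cover. *)
Let nu_null (A : set (measurableTypeR R)) : measurable A -> A `<=` `]0, 1] ->
  lebesgue_measure A = 0%E -> nu A = 0%E.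
Proof.
move=> mA A01 A0; apply/eqP; rewrite eq_le measure_ge0 andbT.
apply/lee_addgt0Pr => e e0; rewrite add0e.
have [d d0 H] := acG e0.
(* Lebesgue measure is by construction the outer measure generated by interval lengths, whence the
   cover. *)
have : ((wlength idfun)^*%mu A < d%:E)%E.
  by rewrite (_ : _ A = lebesgue_measure A)// A0 lte_fin.
move=> /ereal_inf_lt[_ [B [ocB AB] <-]] Bd.
(* The cover is cut down to where [G] is known to be absolutely continuous. *)
pose C j := B j `&` `]0, 1].
have ocC j : ocitv (C j) by apply: ocitvI; [exact: ocB|exact: is_ocitv].
have mC j : (measurable (C j : set (measurableTypeR R))).
  by apply: sub_sigma_algebra; exact: ocC.
pose D n := \big[setU/set0]_(j < n) C j.
have mD n : measurable (D n : set (measurableTypeR R)).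
  by apply: bigsetU_measurable => i _; exact: mC.
have AD : A `<=` \bigcup_n D n.
  move=> x Ax; have [j _ Bx] := AB _ Ax; exists j.+1 => //.
  by rewrite /D -bigcup_mkord; exists j => //=; split => //; exact: A01.
apply: (@le_trans _ _ (nu (\bigcup_n D n))).
  by apply: le_measure; rewrite ?inE//; exact: bigcup_measurable.
have ndD : nondecreasing_seq D.
  by move=> i j ij; apply/subsetPset; rewrite /D; exact: subset_bigsetU.
have cvgD := @nondecreasing_cvg_mu _ _ _ nu D mD (bigcup_measurable (fun k _ => mD k)) ndD.
rewrite -(cvg_lim _ cvgD)//; apply: lime_le; first by apply/cvg_ex; eexists; exact: cvgD.
apply: nearW => n; apply: (@ocitv_bigcup_small _ F e d) => //.
- move=> N a b ab01 abdis sd; apply: le_lt_trans (H N a b ab01 abdis sd).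
  apply: ler_sum => i _; have [? [? ?]] := ab01 i.
  by rewrite -(FE (x := a i)) -?(FE (x := b i))//; lra.
- by move=> j x [].
apply: le_lt_trans Bd; apply: (@le_trans _ _ (\sum_(j < n) lebesgue_measure (B j))%E).
  apply: le_trans (le_mu_bigsetU _ _) _; first by move=> i _; exact: mC.
  apply: lee_sum => i _; apply: le_measure; rewrite ?inE//.
    by apply: sub_sigma_algebra; exact: ocB.
  exact: subIsetl.
rewrite (eq_bigr (fun j : 'I_n => wlength idfun (B j))); last first.
  by move=> i _; apply: measurable_mu_extE; exact: ocB.
rewrite -(big_mkord xpredT (fun j => wlength idfun (B j))).
apply: nneseries_lim_ge => k _ _; exact: measure_ge0.
Qed.

(** The density is the Radon-Nikodym derivative of [nu] restricted to the half-open unit interval,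
    where it is finite; domination is [nu_null]. *)
Lemma abs_cont01_nondecreasing_density : exists h : R -> R,
  lebesgue_measure.-integrable setT (EFin \o h) /\
  forall x y, 0 <= x -> x <= y -> y <= 1 ->
    G y - G x = \int[lebesgue_measure]_(t in `]x, y]) h t.
Proof.
have nu_fin : (nu `](0%R : R), (1%R : R)]%classic < +oo)%E.
  by rewrite lebesgue_stieltjes_measure_itv_oc// ltry.
have m01 : measurable (`](0 : R), (1 : R)]%classic : set (measurableTypeR R)) by exact: measurable_itv.
have [] := @radon_nikodym_sigma_finite _ _ _ (@lebesgue_measure R) (mfrestr m01 nu_fin).
  apply/null_content_dominatesP => A mA A0; rewrite /= /mfrestr /mrestr/=.
  have mA01 : measurable (A `&` (`](0 : R), (1 : R)]%classic : set (measurableTypeR R))).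
    exact: measurableI.
  apply: (nu_null mA01); first exact: subIsetr.
  apply/eqP; rewrite -measure_le0 -A0 le_measure ?inE//.
move=> h [h0 hfin inth nuE]; exists (fine \o h).
have hE : EFin \o (fine \o h) = h by apply/funext => x /=; rewrite fineK.
split => [|x y x0 xy y1]; first by rewrite hE.
rewrite /Rintegral; under eq_integral do rewrite fineK//.
rewrite -nuE; last exact: measurable_itv.
rewrite /= /mfrestr /mrestr setIidl.
  by rewrite lebesgue_stieltjes_measure_itv_oc//= !FE ?(le_trans x0)// (le_trans xy).
by move=> z /=; rewrite !in_itv/= => /andP[xz zy]; rewrite (le_lt_trans x0) ?(le_trans zy).
Qed.

End monotone.

(** * Integral representation and almost everywhere derivative *)

Section abs_cont01_theory.
Context {R : realType}.
Notation mu := (@lebesgue_measure R).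
Implicit Types g : R -> R.

Lemma abs_cont01B g1 g2 : abs_cont01 g1 -> abs_cont01 g2 ->
  abs_cont01 (fun x => g1 x - g2 x).
Proof.
move=> ac1 ac2 e e0; have e20 : 0 < e / 2 by rewrite divr_gt0.
have [d1 d10 H1] := ac1 _ e20; have [d2 d20 H2] := ac2 _ e20.
exists (Num.min d1 d2); first by rewrite lt_min d10.
move=> N a b ab01 abdis; rewrite lt_min => /andP[sd1 sd2].
have s1 := H1 N a b ab01 abdis sd1; have s2 := H2 N a b ab01 abdis sd2.
rewrite (splitr e); apply: le_lt_trans (ltrD s1 s2); rewrite -big_split/=.
apply: ler_sum => i _; rewrite (_ : _ - _ - _ =
  (g1 (b i) - g1 (a i)) - (g2 (b i) - g2 (a i))); last by ring.
exact: ler_normB.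
Qed.

(* The total variation [V] of [g], and [V - g], are nondecreasing and
   absolutely continuous. *)
Lemma abs_cont01_density g : abs_cont01 g -> exists h : R -> R,
  mu.-integrable setT (EFin \o h) /\
  forall x y, 0 <= x -> x <= y -> y <= 1 -> g y - g x = \int[mu]_(t in `]x, y]) h t.
Proof.
move=> acg; pose V x := fine (total_variation 0 x g).
have bvg := abs_cont01_bounded_variation acg.
have acV : abs_cont01 V := abs_cont01_total_variation acg.
have finTV (a b : R) : 0 <= a -> a <= b -> b <= 1 ->
    total_variation a b g \is a fin_num.
  move=> a0 ab b1; apply/bounded_variationP => //.
  apply: (bounded_variationr a0 ab).
  by apply: bounded_variationl b1 bvg; exact: le_trans ab.
(* This domination of increments is what makes both [V] and [V - g] monotone. *)
have VE x y : 0 <= x -> x <= y -> y <= 1 -> `|g y - g x| <= V y - V x.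
  move=> x0 xy y1; rewrite /V (total_variationD g x0 xy) fineD ?finTV ?(le_trans xy)//.
  rewrite addrAC subrr add0r -lee_fin fineK ?finTV//.
  exact: total_variation_ge.
have [h1 [ih1 Vh1]] : exists h : R -> R, mu.-integrable setT (EFin \o h) /\
    forall x y, 0 <= x -> x <= y -> y <= 1 -> V y - V x = \int[mu]_(t in `]x, y]) h t.
  apply: abs_cont01_nondecreasing_density => // x y x0 xy y1.
  by rewrite -subr_ge0 (le_trans _ (VE x y _ _ _)).
have [h2 [ih2 Vh2]] : exists h : R -> R, mu.-integrable setT (EFin \o h) /\
    forall x y, 0 <= x -> x <= y -> y <= 1 ->
      (V y - g y) - (V x - g x) = \int[mu]_(t in `]x, y]) h t.
  apply: abs_cont01_nondecreasing_density; last exact: abs_cont01B.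
  move=> x y x0 xy y1; have := VE x y x0 xy y1; have := ler_norm (g y - g x); lra.
exists (fun x => h1 x - h2 x); split.
  exact: (integrableB measurableT ih1 ih2).
move=> x y x0 xy y1; rewrite RintegralB//.
- by rewrite -Vh1// -Vh2//; lra.
- exact: integrableS ih1.
- exact: integrableS ih2.
Qed.

(** The density is also the derivative: Lebesgue differentiation applies to the primitive of [h],
    and [g] differs from it by the constant [g 0]. The two are compared on the unit interval only,
    hence the restriction to interior [x]. *)
Lemma abs_cont01_ae_derive g : abs_cont01 g -> exists h : R -> R,
  [/\ mu.-integrable setT (EFin \o h),
   forall x y, 0 <= x -> x <= y -> y <= 1 -> g y - g x = \int[mu]_(t in `]x, y]) h t &
   {ae mu, forall x, 0 < x < 1 -> derivable g x 1 /\ derive1 g x = h x}].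
Proof.
move=> /abs_cont01_density[h [ih gh]]; exists h; split => //.
have lh : locally_integrable setT h by exact: open_integrable_locally openT ih.
have ih0 y : mu.-integrable [set` Interval (BRight (0:R)) (BRight y)] (EFin \o h).
  exact: integrableS ih.
have := @FTC1 R h (BRight 0) ih0 lh.
apply: filterS; first exact: (ae_filter_ringOfSetsType mu).
move=> x /[swap] /andP[x0 x1].
rewrite lte_fin => /(_ x0)[dF F'].
pose F y := \int[mu]_(t in `]0, y]) h t.
have gF : {near x, (fun y => F y + g 0) =1 g}.
  near=> y; rewrite /F -gh ?subrK//.
  - by apply/ltW; near: y; exact: lt_nbhsr.
  - by apply/ltW; near: y; exact: lt_nbhsl.
have dF0 : derivable (fun y => F y + g 0) x 1.
  exact: (derivableD dF (derivable_cst (g 0) x 1)).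
split; first exact: near_eq_derivable gF dF0.
rewrite derive1E -(near_eq_derive _ gF) (deriveD dF (derivable_cst (g 0) x 1)) derive_cst addr0.
by rewrite -derive1E.
Unshelve. all: by end_near. Qed.

Lemma abs_cont01_ae_derivable g : abs_cont01 g ->
  {ae mu, forall x, 0 < x < 1 -> derivable g x 1}.
Proof.
move=> /abs_cont01_ae_derive[h [_ _]].
apply: filterS; first exact: (ae_filter_ringOfSetsType mu).
by move=> x /[apply] -[].
Qed.

(** Lets an explicit formula [phi] replace [derive1 g]. Agreement is known only almost everywhere in
    the interior, so the endpoints are first discarded as null. *)
Lemma abs_cont01_le_integral g (phi : R -> R) : abs_cont01 g ->
  measurable_fun (`[(0 : R), (1 : R)]%classic : set R) phi ->
  {ae mu, forall x, 0 < x < 1 -> derive1 g x = phi x} ->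
  forall x y, 0 <= x -> x <= y -> y <= 1 ->
    (`|g y - g x|%:E <= \int[mu]_(u in `[x, y]) `|phi u|%:E)%E.
Proof.
move=> acg mphi g'phi x y x0 xy y1.
have [h [ih gh g'h]] := abs_cont01_ae_derive acg.
have mh (D : set R) : measurable D -> measurable_fun D (fun u => `|h u|%:E).
  move=> mD; apply/measurable_EFinP/measurableT_comp => //.
  by apply/measurable_EFinP/measurable_funTS; exact: (measurable_int mu).
have mp (D : set R) : measurable D -> D `<=` `[0, 1] -> measurable_fun D (fun u => `|phi u|%:E).
  move=> mD D01; apply/measurable_EFinP/measurableT_comp => //.
  exact: measurable_funS mphi.
have sub (b1 b2 : bool) : [set` Interval (BSide b1 x) (BSide b2 y)] `<=` (`[0, 1] : set R).
  move=> z; case: b1; case: b2; rewrite /= !in_itv/= => /andP[xz zy];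
    apply/andP; split; lra.
rewrite gh// EFin_normr_Rintegral//; last exact: integrableS ih.
apply: le_trans (le_abse_integral _ _ _) _ => //.
  by apply: measurable_funTS; exact: (measurable_int mu).
rewrite -integral_itv_bndo_bndc; last exact: mh.
rewrite -[leRHS]integral_itv_bndo_bndc; last by apply: mp.
rewrite -[leRHS]integral_itv_obnd_cbnd; last by apply: mp.
rewrite (@ge0_ae_eq_integral _ _ _ mu _ (fun u => `|h u|%:E) (fun u => `|phi u|%:E))//.
- exact: mh.
- by apply: mp.
apply: (@filterS2 _ _ (ae_filter_ringOfSetsType mu) _ _ _ _ g'phi g'h).
move=> u + + /=; rewrite in_itv/= => + + /andP[xu uy].
have u01 : 0 < u < 1 by rewrite (le_lt_trans x0)//= (lt_le_trans uy).
by move=> /(_ u01) <- /(_ u01)[_ ->].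
Qed.

End abs_cont01_theory.

(** * Bernstein polynomials and the nodes *)

Section bernstein.
Context {R : realType}.
Implicit Types (n k : nat) (y c : R) (phi : nat -> R).

Lemma bern_ge0 n k y : 0 <= y <= 1 -> 0 <= bern n k y.
Proof.
move=> /andP[y0 y1]; rewrite /bern !mulr_ge0// ?exprn_ge0//.
by rewrite subr_ge0.
Qed.

Lemma bern_small n k y : (n < k)%N -> bern n k y = 0.
Proof. by move=> nk; rewrite /bern bin_small// !mul0r. Qed.

Lemma continuous_bern n k : continuous (bern n k : R -> R).
Proof.
rewrite (_ : bern n k = fun y => 'C(n, k)%:R * XMonemX k (n - k) y); last first.
  by apply/funext => y; rewrite /bern /XMonemX mulrA.
by move=> y; apply: cvgMr; exact: continuous_XMonemX.
Qed.

Lemma bernS0 n y : bern n.+1 0 y = (1 - y) * bern n 0 y.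
Proof. by rewrite /bern !bin0 !subn0 exprS; ring. Qed.

Lemma bernSS n k y :
  bern n.+1 k.+1 y = y * bern n k y + (1 - y) * bern n k.+1 y.
Proof.
(* For [n <= k] truncated subtraction breaks the recursion of exponents, but there [bern n k.+1] is
   zero. *)
have [nk|kn] := leqP n k.
  rewrite (@bern_small n k.+1) ?ltnS// /bern binS (@bin_small n k.+1) ?ltnS// add0n.
  by rewrite subSS exprS; ring.
by rewrite /bern binS natrD subSS -(subnSK kn) !exprS; ring.
Qed.

(** Conditioning a binomial variable on one of its trials; moments then follow by induction. *)
Lemma sum_bernS n y phi :
  \sum_(k < n.+2) bern n.+1 k y * phi k =
  y * (\sum_(k < n.+1) bern n k y * phi k.+1) +
  (1 - y) * (\sum_(k < n.+1) bern n k y * phi k).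
Proof.
rewrite big_ord_recl/= bernS0.
under eq_bigr do rewrite /bump/= add1n bernSS mulrDl.
rewrite big_split/= addrCA; congr (_ + _).
  by rewrite mulr_sumr; apply: eq_bigr => k _; rewrite mulrA.
rewrite mulr_sumr [in RHS]big_ord_recl/= [in LHS]big_ord_recr/=.
rewrite (@bern_small n n.+1)// mulr0 mul0r addr0; congr (_ + _); first by rewrite -mulrA.
by apply: eq_bigr => k _; rewrite /bump/= add1n -mulrA.
Qed.

Lemma sum_bern n y : \sum_(k < n.+1) bern n k y = 1.
Proof.
suff: \sum_(k < n.+1) bern n k y * 1 = 1 by under eq_bigr do rewrite mulr1.
elim: n => [|n ih]; first by rewrite big_ord1 /bern bin0 subn0 !expr0 !mulr1.
by rewrite (sum_bernS n y (fun=> 1)) ih; ring.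
Qed.

(** The second moment about [- c]. The free shift closes the induction, since a successful trial
    replaces [c] by [1 + c]. *)
Lemma sum_bern_sqr n y c :
  \sum_(k < n.+1) bern n k y * (k%:R + c) ^+ 2 =
  (n%:R * y + c) ^+ 2 + n%:R * (y * (1 - y)).
Proof.
elim: n c => [|n ih] c.
  by rewrite big_ord1 /bern bin0 subn0 !expr0 !mulr1 !mul0r mul1r addr0.
rewrite (sum_bernS n y (fun k => (k%:R + c) ^+ 2)) ih.
under eq_bigr do rewrite -natr1 -addrA.
by rewrite ih -natr1; ring.
Qed.

(** The degree is [n] but the spacing is [1 / n.+1], so the second moment about [n.+1 * y] carries
    an extra [y ^+ 2]; bounding it by 1 produces the cubic term. *)
Lemma sum_bern_dist n y : 0 <= y <= 1 ->
  \sum_(k < n.+1) bern n k y * `|k%:R / n.+1%:R - y| <=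
  1 / (2 * Num.sqrt n.+1%:R) + 1 / Num.sqrt n.+1%:R ^+ 3.
Proof.
move=> y01; have /andP[y0 y1] := y01.
set s : R := Num.sqrt n.+1%:R.
have s0 : 0 < s by rewrite sqrtr_gt0.
have s2 : s ^+ 2 = n.+1%:R by rewrite sqr_sqrtr.
have s20 : 0 <= s ^- 2 by rewrite invr_ge0 exprn_ge0// ltW.
have si0 : 0 <= s^-1 by rewrite invr_ge0 ltW.
have absE (k : 'I_n.+1) : bern n k y * `|k%:R / n.+1%:R - y| <=
    s ^- 2 * (s^-1 * (bern n k y * (k%:R + - (n.+1%:R * y)) ^+ 2) + s / 4 * bern n k y).
  rewrite (_ : _ * (_ + _) = bern n k y * (s ^- 2 *
    (s^-1 * (k%:R + - (n.+1%:R * y)) ^+ 2 + s / 4))); last by ring.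
  apply: ler_wpM2l; first exact: bern_ge0.
  rewrite -s2; set u := k%:R - s ^+ 2 * y.
  have -> : k%:R / s ^+ 2 - y = s ^- 2 * u by rewrite /u; field; rewrite gt_eqF.
  rewrite normrM (@ger0_norm _ (s ^- 2))//.
  apply: ler_wpM2l => //.
  (* AM-GM: 2 |u| (s/2) <= u^2 + (s/2)^2 *)
  have : 0 <= s^-1 * (`|u| - s / 2) ^+ 2 by rewrite mulr_ge0 ?sqr_ge0.
  rewrite sqrrB real_normK ?num_real//.
  rewrite (_ : _ * _ = (s^-1 * u ^+ 2 + s / 4) - `|u|) ?subr_ge0//.
  by field; rewrite gt_eqF.
apply: le_trans; first by apply: ler_sum => k _; exact: absE.
rewrite -mulr_sumr big_split/= -!mulr_sumr sum_bern_sqr sum_bern -s2.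
have -> : n%:R = s ^+ 2 - 1 by rewrite s2 -natr1 addrK.
rewrite (_ : 1 / (2 * s) + 1 / s ^+ 3 = s ^- 2 * (s^-1 * (s ^+ 2 / 4 + 1) + s / 4 * 1)); last first.
  by field; rewrite gt_eqF.
rewrite ler_wpM2l// lerD2r ler_wpM2l//.
have : 0 <= s ^+ 2 * (y - 1 / 2) ^+ 2 by rewrite mulr_ge0 ?sqr_ge0.
have : y * (1 - y) >= 0 by rewrite mulr_ge0// subr_ge0.
have : y ^+ 2 <= 1 by rewrite expr_le1.
nra.
Qed.

End bernstein.

(** * The logarithmic nodes *)

Section a_next.
Context {R : realType}.
Variable (m : R).
Hypothesis m0 : 0 < m.
Implicit Types (n : nat) (x : R).

(** The bound [ln (1 + t) <= t] at [t = - (u / (1 + u))], where [1 + t] is the inverse of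
    [1 + u]. *)
Lemma ln1D_ge_div (u : R) : 0 <= u -> u / (1 + u) <= ln (1 + u).
Proof.
move=> u0; have u1 : 0 < 1 + u by rewrite ltr_wpDr.
have : ln (1 + - (u / (1 + u))) <= - (u / (1 + u)).
  apply: le_ln1Dx; rewrite ltrN2 ltr_pdivrMr// mul1r; lra.
rewrite (_ : 1 + - (u / (1 + u)) = (1 + u)^-1); last by field; rewrite gt_eqF.
by rewrite lnV ?posrE// lerN2.
Qed.

Let N n : R := n.+1%:R * (1 + m).

Let N_ge n : n.+1%:R <= N n.
Proof. by rewrite /N ler_peMr// lerDl ltW. Qed.

Let N_gt0 n : 0 < N n.
Proof. by apply: lt_le_trans (N_ge n); rewrite ltr0n. Qed.

Let L n : R := ln (1 + 1 / N n).

Let L_gt0 n : 0 < L n.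
Proof. by rewrite ln_gt0// ltrDl divr_gt0. Qed.

Let L_le n : L n <= 1 / N n.
Proof. by apply: le_ln1Dx; rewrite (@lt_le_trans _ _ 0)// divr_ge0// ltW. Qed.

Let L_ge n : 1 / (N n + 1) <= L n.
Proof.
have := @ln1D_ge_div (1 / N n); rewrite divr_ge0 ?(ltW (N_gt0 n))// => /(_ isT).
apply: le_trans; rewrite le_eqVlt; apply/orP; left; apply/eqP.
by field; rewrite !gt_eqF// ?addr_gt0.
Qed.

Lemma a_next0 n : a_next m n 0 = 0.
Proof. by rewrite /a_next mul0r addr0 ln1 mul0r. Qed.

Lemma a_next1 n : a_next m n 1 = 1.
Proof. by rewrite /a_next -/(N n) -/(L n) divff// gt_eqF. Qed.

(** Enclosing both logarithms by [u / (1 + u) <= ln (1 + u) <= u] puts their quotient within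
    [1 / N n] of [x]. *)
Lemma a_next_dist n x : 0 <= x <= 1 -> `|a_next m n x - x| <= 1 / n.+1%:R.
Proof.
move=> /andP[x0 x1]; apply: (@le_trans _ _ (1 / N n)); last first.
  by rewrite !div1r lef_pV2 ?posrE ?ltr0n.
rewrite /a_next -/(N n) -/(L n).
have l1 : ln (1 + x / N n) <= x / N n.
  by apply: le_ln1Dx; rewrite (@lt_le_trans _ _ 0)// divr_ge0// ltW.
have := @ln1D_ge_div (x / N n); rewrite divr_ge0 ?(ltW (N_gt0 n))// => /(_ isT) l2.
have Nx : 0 < N n + x by rewrite ltr_wpDr.
have l3 : x / (N n + x) <= ln (1 + x / N n).
  apply: le_trans l2; rewrite le_eqVlt; apply/orP; left; apply/eqP.
  by field; rewrite !gt_eqF// ltr_wpDr// divr_ge0// ltW.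
rewrite ler_distl; apply/andP; split.
  rewrite ler_pdivlMr//; apply: le_trans l3.
  (* Replacing [L n] by its upper bound is legitimate only when its coefficient is nonnegative. *)
  have [xN|xN] := leP (x - 1 / N n) 0.
    by apply: (@le_trans _ _ 0); rewrite ?mulr_le0_ge0 ?(ltW (L_gt0 n))// divr_ge0// ltW.
  apply: le_trans (ler_wpM2l (ltW xN) (L_le n)) _.
  rewrite ler_pdivlMr// -subr_ge0.
  rewrite (_ : _ - _ = ((x ^+ 0 - x ^+ 2) / N n + x / N n ^+ 2)); last first.
    by field; rewrite gt_eqF.
  rewrite addr_ge0 ?divr_ge0 ?exprn_ge0 ?(ltW (N_gt0 n))//.
  by rewrite expr0 subr_ge0 expr_le1.
rewrite ler_pdivrMr//; apply: le_trans l1 _.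
apply: (@le_trans _ _ ((x + 1 / N n) * (1 / (N n + 1)))); last first.
  apply: ler_wpM2l; last exact: L_ge.
  by rewrite addr_ge0// divr_ge0// ltW.
rewrite -subr_ge0 (_ : _ - _ = (1 - x) / (N n * (N n + 1))); last first.
  by field; rewrite !gt_eqF// addr_gt0.
by rewrite divr_ge0 ?subr_ge0// mulr_ge0 ?addr_ge0// ltW.
Qed.

Lemma a_next_increasing n : {in `[0, 1] &, {homo a_next m n : x y / x < y}}.
Proof.
move=> x y; rewrite !in_itv/= => /andP[x0 x1] /andP[y0 y1] xy.
rewrite /a_next -/(N n) -/(L n) ltr_pM2r ?invr_gt0//.
have pos z : 0 <= z -> 0 < 1 + z / N n.
  by move=> z0; rewrite ltr_wpDr// divr_ge0// ltW.
by rewrite ltr_ln ?posrE ?pos// ltrD2l ltr_pM2r// invr_gt0.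
Qed.

Lemma a_next_itv n x : 0 <= x <= 1 -> 0 <= a_next m n x <= 1.
Proof.
move=> /andP[x0 x1].
have homo : {in `[0, 1] &, {homo a_next m n : x y / x <= y}}.
  move=> u v u01 v01; rewrite le_eqVlt => /predU1P[->//|uv].
  exact/ltW/a_next_increasing.
apply/andP; split.
  by rewrite -[leLHS](a_next0 n); apply: homo; rewrite ?in_itv/= ?lexx ?ler01 ?x0.
by rewrite -[leRHS](a_next1 n); apply: homo; rewrite ?in_itv/= ?lexx ?ler01 ?x0.
Qed.

(** The open half-line contains the closed unit interval, so the one-sided limits that the
    substitution rule demands at 0 and 1 come from ordinary continuity. *)
Lemma is_derive_a_next n x : - N n < x ->
  is_derive x 1 (a_next m n) ((N n + x)^-1 / L n).
Proof.
move=> Nx; have xpos : 0 < 1 + x / N n.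
  by rewrite -(@divff _ (N n)) ?gt_eqF// -mulrDl divr_gt0// -ltrBlDl sub0r.
have dlin : is_derive x 1 (fun z : R => 1 + z / N n) (N n)^-1.
  apply: is_derive_eq.
  by rewrite scaler0 !add0r mul1r [_%:A]mulr1.
have dln := @is_derive1_comp R (@ln R) _ x _ _ (is_derive1_ln xpos) dlin.
have := is_deriveZ (L n)^-1 dln.
rewrite (_ : _ \*: _ = a_next m n); last by apply/funext => z; exact: mulrC.
move=> dE; rewrite (_ : _ / _ = (L n)^-1 *: ((1 + x / N n)^-1 / N n))//.
rewrite [RHS]mulrC; congr (_ / _).
by field; rewrite !gt_eqF// -ltrBlDl sub0r.
Qed.

Lemma derive1_a_next n x : - N n < x ->
  derive1 (a_next m n) x = (N n + x)^-1 / L n.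
Proof. by move=> /(is_derive_a_next)[_ <-]; rewrite derive1E. Qed.

Lemma continuous_derive1_a_next n x : - N n < x ->
  {for x, continuous (derive1 (a_next m n))}.
Proof.
move=> Nx; rewrite /prop_for/continuous_at derive1_a_next//.
have : (fun z => (N n + z)^-1 / L n) z @[z --> x] --> (N n + x)^-1 / L n.
  apply: cvgMl; apply: cvgV; first by rewrite gt_eqF// -ltrBlDl sub0r.
  by apply: cvgD; [exact: cvg_cst|exact: cvg_id].
apply: cvg_trans; apply: near_eq_cvg; near=> z.
by rewrite derive1_a_next//; near: z; exact: lt_nbhsr.
Unshelve. all: by end_near. Qed.

Lemma measurable_a_next n : measurable_fun setT (a_next m n).
Proof.
apply: measurable_funM => //; apply: measurableT_comp => //.
by apply: measurable_funD => //; apply: measurable_funM.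
Qed.

Lemma measurable_bern_a_next n k :
  measurable_fun setT (fun x => bern n k (a_next m n x)).
Proof.
apply: (measurableT_comp (continuous_measurable_fun (@continuous_bern R n k))).
exact: measurable_a_next.
Qed.

(** A beta integral: [B(k + 1, n - k + 1)] is the inverse of [n.+1 * 'C(n, k)]. *)
Lemma integral_bern n k : (k <= n)%N ->
  (\int[lebesgue_measure]_(y in `[(0%R : R), 1%R]) (bern n k y)%:E = (1 / n.+1%:R)%:E)%E.
Proof.
move=> kn.
have -> : (\int[lebesgue_measure]_(y in `[(0%R : R), 1%R]) (bern n k y)%:E =
    \int[lebesgue_measure]_(y in `[(0%R : R), 1%R]) ('C(n, k)%:R%:E * (XMonemX k (n - k) y)%:E))%E.
  by apply: eq_integral => y _; rewrite -EFinM /bern /XMonemX mulrA.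
rewrite integralZl//; last exact: integrable_XMonemX.
have -> : (\int[lebesgue_measure]_(y in `[(0%R : R), 1%R]) (XMonemX k (n - k) y)%:E =
    (beta_fun k.+1 (n - k).+1)%:E)%E.
  rewrite EFin_beta_fun/= [LHS]integral_mkcond; apply: eq_integral => y _.
  by rewrite restrict_EFin.
rewrite -EFinM beta_fun_fact subnKC//; congr (_%:E).
by rewrite mulrA -natrM bin_fact// factS natrM invfM mulrCA divff ?mulr1 ?div1r//.
Qed.

Lemma integral_bern_a_next n k : (k <= n)%N ->
  (\int[lebesgue_measure]_(x in `[(0%R : R), 1%R]) (bern n k (a_next m n x))%:E <=
    (Kmu m / n.+1%:R)%:E)%E.
Proof.
move=> kn.
have subst := @integration_by_substitution_increasing R (a_next m n) (bern n k) 0 1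
   ler01 (@a_next_increasing n).
have N0 x : 0 <= x -> - N n < x by move=> x0; rewrite (lt_le_trans _ x0)// oppr_lt0.
have derx x : 0 <= x -> derivable (a_next m n) x 1.
  by move=> /N0/is_derive_a_next[].
have contx x : 0 <= x -> {for x, continuous (a_next m n)}.
  by move=> /derx/derivable1_diffP/differentiable_continuous.
rewrite (a_next0 n) (a_next1 n) integral_bern// in subst.
have dcont := @continuous_derive1_a_next n.
have {}subst : (1 / n.+1%:R)%:E =
  (\int[lebesgue_measure]_(x in `[0%R, 1%R])
      (((bern n k \o a_next m n) * derive1 (a_next m n)) x)%:E)%E.
  apply: subst.
  - by move=> x; rewrite in_itv/= => /andP[x0 _]; apply/dcont/N0/ltW.
  - apply/cvg_ex; exists (derive1 (a_next m n) 0).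
    by apply: cvg_at_right_filter; apply/dcont/N0.
  - apply/cvg_ex; exists (derive1 (a_next m n) 1).
    by apply: cvg_at_left_filter; apply/dcont/N0.
  - split; first by move=> x; rewrite in_itv/= => /andP[x0 _]; apply/derx/ltW.
    + by apply: cvg_at_right_filter; apply: contx.
    + by apply: cvg_at_left_filter; apply: contx.
  - by apply: continuous_subspaceT; exact: continuous_bern.
(* The derivative is [1 / ((N n + x) * L n)], and [L n <= 1 / N n] gives [(N n + x) * L n <= 1 + x /
   N n <= 1 + 1 / (1 + m)]. *)
have le_a' x : 0 <= x <= 1 -> 1 <= Kmu m * derive1 (a_next m n) x.
  move=> /andP[x0 x1]; rewrite derive1_a_next ?N0// -invfM mulrC ler_pdivlMl.
    rewrite mulr1; apply: le_trans (ler_wpM2l _ (L_le n)) _.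
      by rewrite addr_ge0// ltW.
    rewrite mulrDl mulrA mulr1 divff ?gt_eqF// /Kmu lerD2l.
    rewrite mulrA mulr1 ler_pdivrMr//.
    rewrite (@le_trans _ _ 1)// div1r ler_pdivlMl ?mulr1 ?addr_gt0//.
    by rewrite /N ler_peMl ?ler1n// addr_ge0// ltW.
  by rewrite mulr_gt0// ltr_wpDr.
have m01 : measurable (`[(0 : R), (1 : R)]%classic : set (measurableTypeR R)).
  exact: measurable_itv.
have mba : measurable_fun (`[(0 : R), (1 : R)]%classic : set R)
    (fun x => bern n k (a_next m n x)).
  by apply: measurable_funTS; exact: measurable_bern_a_next.
have mda : measurable_fun (`[(0 : R), (1 : R)]%classic : set R) (derive1 (a_next m n)).
  apply: subspace_continuous_measurable_fun => //.
  by apply: continuous_in_subspaceT => x; rewrite inE/= in_itv/= => /andP[x0 _]; apply/dcont/N0.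
have K0 : 0 <= Kmu m by rewrite addr_ge0// divr_ge0// addr_ge0// ltW.
have ba0 x : 0 <= x <= 1 -> 0 <= bern n k (a_next m n x).
  by move=> x01; apply/bern_ge0/a_next_itv.
have da0 x : 0 <= x <= 1 -> 0 <= derive1 (a_next m n) x.
  move=> /andP[x0 _]; rewrite derive1_a_next ?N0//.
  by apply: divr_ge0; [rewrite invr_ge0 addr_ge0//; exact: ltW|exact: ltW].
rewrite -(div1r n.+1%:R) EFinM subst -ge0_integralZl//.
- apply: ge0_le_integral => //.
  + exact/measurable_EFinP.
  + apply/measurable_EFinP; apply: measurable_funM => //; exact: measurable_funM.
  + move=> x; rewrite /= in_itv/= => x01; rewrite -EFinM lee_fin mulrCA.
    by rewrite ler_peMr ?ba0// le_a'.
- apply/measurable_EFinP; exact: measurable_funM.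
- move=> x; rewrite /= in_itv/= => x01.
  by rewrite lee_fin mulr_ge0 ?ba0 ?da0.
Qed.

(** A real [sup] is informative only for bounded sets: [a_next_dist] supplies the bound, and the
    point 0 a nonnegative member. *)
Lemma gamma_n_ge0 n : 0 <= gamma_n m n.
Proof.
rewrite /gamma_n; set E := (X in sup X); apply: (@le_trans _ _ `|a_next m n 0 - 0|) => //.
apply: ub_le_sup; last by exists 0 => //=; rewrite in_itv/= lexx ler01.
exists (1 / n.+1%:R) => _ [x /= x01 <-]; apply: a_next_dist.
by move: x01; rewrite in_itv.
Qed.

End a_next.

(** * Lp seminorms on the unit interval *)

(** The integral of a nonnegative function is a supremum over simple functions below it, so
    monotonicity extends to non-measurable integrands. *)
Lemma le_ge0_integral d (T : measurableType d) (R : realType)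
    (mu : {measure set T -> \bar R}) (D : set T) (f g : T -> \bar R) :
  (forall x, D x -> 0 <= f x)%E -> (forall x, D x -> f x <= g x)%E ->
  (\int[mu]_(x in D) f x <= \int[mu]_(x in D) g x)%E.
Proof.
move=> f0 fg; rewrite integral_mkcond [leRHS]integral_mkcond.
have f0' x : (0 <= (f \_ D) x)%E.
  by rewrite patchE; case: ifPn => // /set_mem/f0.
have fg' x : ((f \_ D) x <= (g \_ D) x)%E.
  by rewrite !patchE; case: ifPn => // /set_mem/fg.
rewrite !ge0_integralTE// => [|x]; last exact: le_trans (fg' x).
apply: ereal_sup_le => /= _ [h hf <-].
by exists h => // x; exact: le_trans (fg' x).
Qed.

Section Lp.
Context {R : realType}.
Notation mu := (@lebesgue_measure R).
Local Notation I01 := (`[(0:R), (1:R)]%classic : set R).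
Variable p : R.
Hypothesis p1 : 1 < p.
Implicit Types f g : R -> R.

Let p0 : 0 < p. Proof. exact: lt_trans p1. Qed.
Let pN0 : p != 0. Proof. by rewrite gt_eqF. Qed.

Lemma pnormE f : pnorm p f = ((\int[mu]_(x in I01) (`|f x| `^ p)%:E) `^ p^-1)%E.
Proof.
by rewrite /pnorm /Lpnorm01; congr (_ `^ _)%E.
Qed.

Lemma pnorm_ge0 f : (0 <= pnorm p f)%E.
Proof. exact: poweR_ge0. Qed.

Lemma measurable_powR_norm (D : set R) f : measurable_fun D f ->
  measurable_fun D (fun x => `|f x| `^ p).
Proof.
move=> mf; have mn : measurable_fun D (fun x => `|f x|) by exact: measurableT_comp.
exact: (measurableT_comp (measurable_powR p) mn).
Qed.

Lemma inLpE f : measurable_fun I01 f -> inLp p f <-> (pnorm p f < +oo)%E.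
Proof.
move=> mf; have pV0 : p^-1 != 0 by rewrite invr_neq0.
rewrite pnormE /inLp; set X := (X in (X < _)%E).
split=> [[_]|]; first exact: poweR_lty.
by move=> /(lty_poweRy pV0).
Qed.

(* [G] need not be measurable: the maximal function is not known to be. *)
Lemma pnorm_le_Lpnorm01 (c : R) f (G : R -> \bar R) : 0 < c ->
  measurable_fun I01 f ->
  (forall x, 0 <= x <= 1 -> (`|f x|%:E <= c%:E * `|G x|)%E) ->
  (pnorm p f <= c%:E * Lpnorm01 p G)%E.
Proof.
move=> c0 mf fG; rewrite pnormE.
have c_ge0 := ltW c0.
have mcf : measurable_fun I01 (fun x => c^-1 * f x) by exact: measurable_funM.
have cp0 : 0 <= c `^ p by exact: powR_ge0.
have Ip0 (H : R -> R) : (0 <= \int[mu]_(x in I01) (`|H x| `^ p)%:E)%E.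
  by apply: integral_ge0 => x _; rewrite lee_fin powR_ge0.
(* The constant is extracted on the side of [f], where measurability is available. *)
have -> : (\int[mu]_(x in I01) (`|f x| `^ p)%:E =
    (c `^ p)%:E * \int[mu]_(x in I01) (`|c^-1 * f x| `^ p)%:E)%E.
  rewrite -ge0_integralZl//.
  - apply: eq_integral => x _; rewrite -EFinM normrM powRM// mulrA.
    rewrite (@ger0_norm _ c^-1) ?invr_ge0// -powRM ?invr_ge0//.
    by rewrite divff ?gt_eqF// powR1 mul1r.
  - apply/measurable_EFinP; exact: (measurable_powR_norm mcf).
rewrite poweRM ?lee_fin// poweR_EFin -powRrM divff// powRr1//.
rewrite lee_pmul2l// /Lpnorm01; apply: gt0_ler_poweR => //.
- by rewrite invr_ge0 ltW.
- by rewrite in_itv/= Ip0 leey.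
- by rewrite in_itv/= leey andbT; apply: integral_ge0 => x _; exact: poweR_ge0.
- apply: le_ge0_integral => x; first by move=> _; rewrite lee_fin powR_ge0.
  rewrite /= in_itv/= => x01; rewrite -poweR_EFin.
  apply: gt0_ler_poweR; first exact: ltW.
  - by rewrite in_itv/= leey andbT lee_fin.
  - by rewrite in_itv/= leey andbT abse_ge0.
  rewrite normrM ger0_norm ?invr_ge0// EFinM lee_pdivrMl//.
  exact: fG.
Qed.

Lemma pnorm_le (c : R) f g : 0 < c -> measurable_fun I01 f ->
  (forall x, 0 <= x <= 1 -> `|f x| <= c * `|g x|) ->
  (pnorm p f <= c%:E * pnorm p g)%E.
Proof.
by move=> c0 mf fg; apply: pnorm_le_Lpnorm01.
Qed.

Lemma pnormD f g : measurable_fun I01 f -> measurable_fun I01 g ->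
  (pnorm p (fun x => f x + g x)%R <= pnorm p f + pnorm p g)%E.
Proof.
move=> mf mg.
(* Minkowski's inequality is applied on the whole line, to extensions by zero. *)
have LE (h : R -> R) : ('N[mu]_p%:E[EFin \o (h \_ I01)] = pnorm p h)%E.
  rewrite pnormE.
  rewrite Lnorm.unlock.
  apply: (congr1 (fun z => poweR z p^-1)).
  rewrite [RHS]integral_mkcond; apply: eq_integral => x _.
  rewrite !patchE /= patchE; case: ifPn => _ //=.
  by rewrite normr0 powR0.
have mE (h : R -> R) : measurable_fun I01 h -> measurable_fun setT (h \_ I01).
  by move=> mh; apply/(measurable_restrictT _ _).1 => //; exact: measurable_itv.
have := @minkowski_EFin _ _ _ mu _ _ p (mE _ mf) (mE _ mg) (ltW p1).
rewrite !LE; apply: le_trans; rewrite -LE le_eqVlt; apply/orP; left; apply/eqP.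
congr (Lnorm _ _ _); apply/funext => x /=; rewrite !patchE.
by case: ifPn => //= _; rewrite addr0.
Qed.

Lemma inLpB f g : inLp p f -> inLp p g -> inLp p (fun x => f x - g x).
Proof.
move=> Lf Lg; have [mf _] := Lf; have [mg _] := Lg.
apply/inLpE; first exact: measurable_funB.
have mNg : measurable_fun I01 (fun x => - g x) by exact: measurableT_comp.
apply: le_lt_trans (pnormD mf mNg) _; rewrite lte_add_pinfty//.
  exact/(inLpE mf).
apply: le_lt_trans (_ : pnorm p (fun x => - g x)%R <= 1%:E * pnorm p g)%E _.
  by apply: pnorm_le => // x _; rewrite normrN mul1r.
by rewrite mul1e; exact/(inLpE mg).
Qed.

Lemma inLp_integrable f : inLp p f -> mu.-integrable I01 (EFin \o f).
Proof.
move=> [mf foo]; apply/integrableP; split; first exact/measurable_EFinP.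
apply: (@le_lt_trans _ _ (\int[mu]_(x in I01) (1%:E + (`|f x| `^ p)%:E))%E).
  apply: le_ge0_integral => x _ /=; first by rewrite lee_fin.
  rewrite -EFinD lee_fin.
  have [f1|f1] := leP `|f x| 1; first by rewrite (le_trans f1)// lerDl powR_ge0.
  by rewrite ler_wpDl// -{1}(@powRr1 _ `|f x|)// ler_powR// ltW.
rewrite ge0_integralD//.
- rewrite integral_cst//= lebesgue_measure_itv/= lte01 oppr0 adde0 mul1e.
  by rewrite lte_add_pinfty// ltry.
- apply/measurable_EFinP; exact: (measurable_powR_norm mf).
Qed.

Lemma inLp_integrable_powR f : inLp p f ->
  mu.-integrable I01 (EFin \o (fun x => `|f x| `^ p)).
Proof.
move=> [mf foo]; apply/integrableP; split.
  apply/measurable_EFinP; exact: (measurable_powR_norm mf).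
by under eq_integral do rewrite /= ger0_norm ?powR_ge0//.
Qed.

Lemma bounded_inLp f (c : R) : measurable_fun I01 f ->
  (forall x, 0 <= x <= 1 -> `|f x| <= c) -> inLp p f.
Proof.
move=> mf fc; split => //.
apply: (@le_lt_trans _ _ (\int[mu]_(x in I01) (`|c| `^ p)%:E)%E).
  apply: le_ge0_integral => x; first by rewrite lee_fin powR_ge0.
  rewrite /= in_itv/= => x01; rewrite lee_fin.
  apply: ge0_ler_powR; rewrite ?nnegrE//; first exact: ltW.
  by rewrite (le_trans (fc _ x01))// ler_norm.
rewrite integral_cst//= lebesgue_measure_itv/= lte01 oppr0 adde0 mule1.
exact: ltry.
Qed.

End Lp.

(** * The Kantorovich operators *)

Section LK.
Context {R : realType}.
Notation mu := (@lebesgue_measure R).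
Local Notation I01 := (`[(0:R), (1:R)]%classic : set R).
Local Notation cell n k := (`[k%:R / n.+1%:R, k.+1%:R / n.+1%:R]%classic : set R).
Variables m p : R.
Hypotheses (m0 : 0 < m) (p1 : 1 < p).
Implicit Types f g h : R -> R.

Lemma cell_sub01 n k : (k < n.+1)%N -> cell n k `<=` I01.
Proof.
move=> kn x; rewrite /= !in_itv/= => /andP[kx xk]; apply/andP; split.
  by apply: le_trans kx; rewrite divr_ge0.
by apply: le_trans xk _; rewrite ler_pdivrMr// mul1r ler_nat.
Qed.

Lemma cell_integrable n k f : (k < n.+1)%N -> mu.-integrable I01 (EFin \o f) ->
  mu.-integrable (cell n k) (EFin \o f).
Proof.
move=> kn; apply: integrableS => //; [exact: measurable_itv..|exact: cell_sub01].
Qed.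

Lemma sum_cell_Rintegral n f : mu.-integrable I01 (EFin \o f) ->
  \sum_(k < n.+1) \int[mu]_(t in cell n k) f t = \int[mu]_(t in I01) f t.
Proof.
move=> intf.
have int0 (k : nat) : (k <= n.+1)%N ->
    mu.-integrable (`[0, k%:R / n.+1%:R]%classic : set R) (EFin \o f).
  move=> kn; apply: integrableS intf => //; [exact: measurable_itv..|].
  apply: subset_itvl; rewrite bnd_simp.
  by rewrite ler_pdivrMr// mul1r ler_nat.
suff H : forall j : nat, (j <= n.+1)%N ->
    \sum_(k < j) \int[mu]_(t in cell n k) f t = \int[mu]_(t in `[0, j%:R / n.+1%:R]) f t.
  by rewrite H// divff// pnatr_eq0.
elim=> [_|j ih jn].
  by rewrite big_ord0 mul0r set_itv1 Rintegral_set1.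
rewrite big_ord_recr/= ih ?(ltnW jn)//.
have jj : (j%:R / n.+1%:R : R) <= j.+1%:R / n.+1%:R.
  by rewrite ler_pM2r ?invr_gt0// ler_nat.
(* Adjacent cells share an endpoint, which is dropped from the new cell. *)
rewrite -[X in _ + X]Rintegral_itv_obnd_cbnd; last first.
  apply: integrableS (cell_integrable jn intf) => //; [exact: measurable_itv..|].
  exact: subset_itv_oc_cc.
rewrite -(Rintegral_itvB (int0 _ jn))//; first by rewrite addrC subrK.
by rewrite bnd_simp divr_ge0.
Qed.

Lemma lnmu_itv x : 0 <= x <= 1 -> ln (1 + m) <= lnmu m x <= ln (2 + m).
Proof.
move=> /andP[x0 x1]; have m0' := m0.
have ? : 0 < 1 + m by lra.
have ? : 0 < 1 + m + x by lra.
have ? : 0 < 2 + m by lra.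
by rewrite /lnmu !ler_ln ?posrE//; apply/andP; split; lra.
Qed.

Lemma ln1m_gt0 : 0 < ln (1 + m).
Proof. by rewrite ln_gt0// ltrDl. Qed.

Lemma ln2m_gt0 : 0 < ln (2 + m).
Proof. by have m0' := m0; rewrite ln_gt0//; lra. Qed.

Lemma lnmu_gt0 x : 0 <= x <= 1 -> 0 < lnmu m x.
Proof. by move=> /lnmu_itv/andP[+ _]; apply: lt_le_trans ln1m_gt0. Qed.

Lemma measurable_lnmu : measurable_fun setT (lnmu m).
Proof. by apply: measurableT_comp => //; exact: measurable_funD. Qed.

Lemma continuous_lnmuV x : 0 <= x <= 1 ->
  {for x, continuous (fun z => (lnmu m z)^-1)}.
Proof.
move=> x01; apply: cvgV; first by rewrite gt_eqF// lnmu_gt0.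
have xpos : 0 < 1 + m + x by case/andP: x01 => x0 _; rewrite ltr_wpDr// addr_gt0.
apply: continuous_comp.
  by apply: cvgD; [exact: cvg_cst|exact: cvg_id].
exact: continuous_ln.
Qed.

Lemma measurable_lnmuV : measurable_fun I01 (fun x => (lnmu m x)^-1).
Proof.
apply: subspace_continuous_measurable_fun; first exact: measurable_itv.
apply: continuous_in_subspaceT => x; rewrite inE/= in_itv/=.
exact: continuous_lnmuV.
Qed.

Lemma fmu_le f x : 0 <= x <= 1 -> `|fmu m f x| <= (ln (1 + m))^-1 * `|f x|.
Proof.
move=> x01; rewrite /fmu normrM mulrC ler_wpM2r//.
rewrite ger0_norm ?invr_ge0 ?(ltW (lnmu_gt0 x01))//.
by rewrite lef_pV2 ?posrE ?lnmu_gt0 ?ln1m_gt0//; case/andP: (lnmu_itv x01).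
Qed.

Lemma measurable_fmu f : measurable_fun I01 f -> measurable_fun I01 (fmu m f).
Proof. by move=> mf; apply: measurable_funM => //; exact: measurable_lnmuV. Qed.

Lemma inLp_fmu f : inLp p f -> inLp p (fmu m f).
Proof.
move=> Lf; have [mf _] := Lf; apply/(inLpE p1); first exact: measurable_fmu.
have c0 : 0 < (ln (1 + m))^-1 by rewrite invr_gt0 ln1m_gt0.
apply: le_lt_trans (pnorm_le p1 c0 (measurable_fmu mf) (@fmu_le f)) _.
by rewrite lte_mul_pinfty ?lee_fin ?(ltW c0)//; apply/(inLpE p1).
Qed.

Lemma measurable_sum_bern_a_next n (c : nat -> R) :
  measurable_fun setT (fun x => \sum_(k < n.+1) bern n k (a_next m n x) * c k).
Proof.
apply: measurable_sum => k; apply: measurable_funM => //.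
exact: measurable_bern_a_next.
Qed.

Lemma measurable_LK n f : measurable_fun setT (LK m n f).
Proof.
apply: measurable_funM; first exact: measurable_lnmu.
exact: (@measurable_sum_bern_a_next n (fun k => n.+1%:R * \int[mu]_(t in cell n k) fmu m f t)).
Qed.

End LK.

(** * Boundedness of the operators in Lp *)

Section LK_bounded.
Context {R : realType}.
Notation mu := (@lebesgue_measure R).
Local Notation I01 := (`[(0:R), (1:R)]%classic : set R).
Local Notation cell n k := (`[k%:R / n.+1%:R, k.+1%:R / n.+1%:R]%classic : set R).
Variables m p : R.
Hypotheses (m0 : 0 < m) (p1 : 1 < p).
Implicit Types f g h : R -> R.

Let p0 : 0 < p. Proof. exact: lt_trans p1. Qed.

Lemma lebesgue_measure_cell n k : mu (cell n k) = (n.+1%:R^-1)%:E.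
Proof.
rewrite lebesgue_measure_itv/= lte_fin ltr_pM2r ?invr_gt0// ltr_nat ltnSn.
by rewrite -EFinB -mulrBl -natrB// subSnn mul1r.
Qed.

Lemma Rintegral_cell_cst n k (c : R) : \int[mu]_(t in cell n k) c = c / n.+1%:R.
Proof.
rewrite Rintegral_cst; last exact: measurable_itv.
by have /= -> := lebesgue_measure_cell n k.
Qed.

Lemma integrable_cell_cst n k (c : R) : mu.-integrable (cell n k) (EFin \o cst c).
Proof.
apply/integrableP; split; first by apply/measurable_EFinP; exact: measurable_cst.
rewrite /= integral_cst/=; last exact: measurable_itv.
by have -> := lebesgue_measure_cell n k; rewrite -EFinM ltry.
Qed.

(* Young's inequality [z a^(p-1) <= z^p / p + a^p / q] is the tangent-line bound
   at [a]; taking for [a] the average of [|h|] and averaging gives Jensen. *)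
Lemma bern_jensen n y h : 0 <= y <= 1 -> inLp p h ->
  (\sum_(k < n.+1) bern n k y * (n.+1%:R * \int[mu]_(t in cell n k) `|h t|)) `^ p <=
  \sum_(k < n.+1) bern n k y * (n.+1%:R * \int[mu]_(t in cell n k) `|h t| `^ p).
Proof.
move=> y01 Lh.
pose c (k : nat) := \int[mu]_(t in cell n k) `|h t|.
pose J (k : nat) := \int[mu]_(t in cell n k) `|h t| `^ p.
rewrite -/(c _) -/(J _); set a := \sum_(k < _) _; set B := \sum_(k < _) _.
have a0 : 0 <= a.
  have c0 k : 0 <= c k by rewrite /c; apply: Rintegral_ge0.
  apply: sumr_ge0 => k _; apply: mulr_ge0; first exact: bern_ge0.
  by apply: mulr_ge0 => //; exact: c0.
have q0 : 0 < p / (p - 1) by rewrite divr_gt0// subr_gt0.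
have pN0 : p != 0 by rewrite gt_eqF.
have pN1 : p - 1 != 0 by rewrite gt_eqF// subr_gt0.
have pq : p^-1 + (p / (p - 1))^-1 = 1.
  by field; rewrite ?pN0 ?pN1.
have young z : 0 <= z -> a `^ (p - 1) * z <= z `^ p / p + a `^ p / (p / (p - 1)).
  move=> z0; rewrite mulrC.
  have := @conjugate_powR R z (a `^ (p - 1)) _ _ z0 (powR_ge0 _ _) p0 q0 pq.
  by rewrite -powRrM mulrCA divff ?mulr1// gt_eqF// subr_gt0.
have intn := integrable_norm (inLp_integrable p1 Lh).
have cellE (k : 'I_n.+1) : a `^ (p - 1) * c k <= J k / p + a `^ p / (p / (p - 1)) / n.+1%:R.
  have ih : mu.-integrable (cell n k) (EFin \o (fun t => `|h t|)).
    exact: cell_integrable (ltn_ord k) intn.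
  have iJ : mu.-integrable (cell n k) (EFin \o (fun t => `|h t| `^ p)).
    by apply: cell_integrable => //; exact: inLp_integrable_powR.
  have mc : measurable (cell n k : set (measurableTypeR R)) by exact: measurable_itv.
  rewrite -RintegralZl// -(Rintegral_cell_cst n k) [J k / p]mulrC -RintegralZl// -RintegralD//.
  - apply: le_Rintegral => //.
    + exact: integrableZl ih.
    + apply: (integrableD mc (integrableZl mc p^-1 iJ) (integrable_cell_cst n k _)).
    + by move=> t _ /=; rewrite [p^-1 * _]mulrC young.
  - exact: integrableZl iJ.
  - exact: integrable_cell_cst.
have aE : a `^ p = \sum_(k < n.+1) bern n k y * n.+1%:R * (a `^ (p - 1) * c k).
  rewrite -mulr_powRB1// {1}/a mulr_suml; apply: eq_bigr => k _.
  by rewrite -/(c k); ring.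
(* Once this average of [young] is known, subtracting its last term leaves the p-th power of [a]
   over [p], at most [B / p]. *)
have : a `^ p <= B / p + a `^ p / (p / (p - 1)).
  rewrite {1}aE; apply: (@le_trans _ _ (\sum_(k < n.+1)
      bern n k y * n.+1%:R * (J k / p + a `^ p / (p / (p - 1)) / n.+1%:R))).
    apply: ler_sum => k _; apply: ler_wpM2l => //.
    by apply: mulr_ge0 => //; exact: bern_ge0.
  rewrite le_eqVlt; apply/orP; left; apply/eqP.
  have EE : a `^ p / (p / (p - 1)) =
      \sum_(k < n.+1) bern n k y * (a `^ p / (p / (p - 1))).
    by rewrite -mulr_suml sum_bern mul1r.
  rewrite [X in _ = _ + X]EE /B mulr_suml -big_split/=.
  apply: eq_bigr => k _; rewrite -/(J k); field.
  by rewrite pN1 pN0 addrC natr1 pnatr_eq0.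
rewrite -lerBlDr (_ : _ - _ = a `^ p / p); last by field; rewrite pN1 pN0.
by rewrite ler_pM2r// invr_gt0.
Qed.

Lemma LK_le n h x : 0 <= x <= 1 -> inLp p h ->
  `|LK m n h x| <= ln (2 + m) / ln (1 + m) *
   \sum_(k < n.+1) bern n k (a_next m n x) *
     (n.+1%:R * \int[mu]_(t in cell n k) `|h t|).
Proof.
move=> x01 Lh; have a01 := a_next_itv m0 n x01.
have Lhm := inLp_fmu m0 p1 Lh.
have l1 := ln1m_gt0 m0; have /andP[_ lx] := lnmu_itv m0 x01.
rewrite /LK normrM (ger0_norm (ltW (lnmu_gt0 m0 x01))) -mulrA.
apply: ler_pM => //; first exact/ltW/lnmu_gt0.
rewrite mulr_sumr; apply: le_trans (ler_norm_sum _ _ _) _; apply: ler_sum => k _.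
rewrite normrM (ger0_norm (bern_ge0 _ _ a01)) mulrCA; apply: ler_wpM2l.
  exact: bern_ge0.
rewrite normrM ger0_norm// mulrCA; apply: ler_wpM2l => //.
have mc : measurable (cell n k : set (measurableTypeR R)) by exact: measurable_itv.
have inth := inLp_integrable p1 Lh; have inthm := inLp_integrable p1 Lhm.
have ih : mu.-integrable (cell n k) (EFin \o (fun t => `|h t|)).
  exact: cell_integrable (ltn_ord k) (integrable_norm inth).
have ihm := cell_integrable (ltn_ord k) inthm.
apply: le_trans (le_normr_Rintegral mc ihm) _.
rewrite -RintegralZl//; apply: le_Rintegral => //.
- exact: cell_integrable (ltn_ord k) (integrable_norm inthm).
- exact: integrableZl ih.
- move=> t /(cell_sub01 (ltn_ord k)); rewrite /= in_itv/=.
  exact: fmu_le.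
Qed.

(** The factor [n.+1] of each cell average cancels against the integral of its Bernstein weight, at
    most [Kmu m / n.+1]; the cell integrals then add up. *)
Lemma pnorm_LK_le n h : inLp p h ->
  (pnorm p (LK m n h) <= (ln (2 + m) / ln (1 + m) * Kmu m)%:E * pnorm p h)%E.
Proof.
move=> Lh; have l1 := ln1m_gt0 m0; have l2 := ln2m_gt0 m0.
pose A x := \sum_(k < n.+1) bern n k (a_next m n x) *
     (n.+1%:R * \int[mu]_(t in cell n k) `|h t|).
pose J (k : nat) := \int[mu]_(t in cell n k) `|h t| `^ p.
have A0 x : 0 <= x <= 1 -> 0 <= A x.
  have c0 k : 0 <= \int[mu]_(t in cell n k) `|h t| by apply: Rintegral_ge0.
  move=> x01; apply: sumr_ge0 => k _; apply: mulr_ge0.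
    exact/bern_ge0/a_next_itv.
  by apply: mulr_ge0 => //; exact: c0.
have J0 k : 0 <= J k by apply: Rintegral_ge0 => t _; exact: powR_ge0.
have rat0 : 0 < ln (2 + m) / ln (1 + m) by rewrite divr_gt0.
apply: (@le_trans _ _ ((ln (2 + m) / ln (1 + m))%:E * pnorm p A)%E).
  apply: pnorm_le => //; first by apply: measurable_funTS; apply: measurable_LK.
  by move=> x x01; rewrite (ger0_norm (A0 _ x01)); exact: LK_le.
rewrite (EFinM (ln (2 + m) / ln (1 + m)) (Kmu m)) -muleA lee_pmul2l//.
have K1 : 1 <= Kmu m by rewrite lerDl divr_ge0// addr_ge0// ltW.
have K0 : 0 < Kmu m := lt_le_trans ltr01 K1.
rewrite !pnormE; set IA := (\int[mu]_(x in _) _)%E; set Ih := (\int[mu]_(x in _) _)%E.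
have Ih0 : (0 <= Ih)%E by apply: integral_ge0 => x _; rewrite lee_fin powR_ge0.
have IhE : Ih = (\sum_(k < n.+1) J k)%:E.
  rewrite sum_cell_Rintegral; last exact: inLp_integrable_powR.
  by rewrite fineK// integrable_fin_num//; exact: inLp_integrable_powR.
have IAh : (IA <= (Kmu m)%:E * Ih)%E.
  apply: (@le_trans _ _ (\int[mu]_(x in I01)
     (\sum_(k < n.+1) ((n.+1%:R * J k)%:E * (bern n k (a_next m n x))%:E)))%E).
    apply: le_ge0_integral => x; first by rewrite lee_fin powR_ge0.
    rewrite /= in_itv/= => x01; rewrite ger0_norm ?A0//.
    under eq_bigr do rewrite -EFinM mulrC.
    by rewrite sumEFin lee_fin; apply: bern_jensen => //; exact: a_next_itv.
  rewrite ge0_integral_sum//.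
  - rewrite IhE -EFinM mulr_sumr -sumEFin; apply: lee_sum => k _.
    rewrite ge0_integralZl//.
    + rewrite (_ : Kmu m * J k = n.+1%:R * J k * (Kmu m / n.+1%:R)); last first.
        by field; rewrite addrC natr1 pnatr_eq0.
      rewrite (EFinM (n.+1%:R * J k)); apply: lee_wpmul2l.
        by rewrite lee_fin; apply: mulr_ge0 => //; exact: J0.
      by apply: integral_bern_a_next => //; rewrite -ltnS.
    + by apply/measurable_EFinP/measurable_funTS; exact: measurable_bern_a_next.
    + by move=> x; rewrite /= in_itv/= => x01; rewrite lee_fin bern_ge0 ?a_next_itv.
    + by rewrite lee_fin mulr_ge0.
  - move=> k; apply/measurable_EFinP/measurable_funTS; apply: measurable_funM => //.
    exact: measurable_bern_a_next.
  - move=> k x; rewrite /= in_itv/= => x01.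
    rewrite -EFinM lee_fin; apply: mulr_ge0; first by apply: mulr_ge0 => //; exact: J0.
    exact/bern_ge0/a_next_itv.
have pV0 : 0 <= p^-1 by rewrite invr_ge0 ltW.
apply: (@le_trans _ _ (((Kmu m)%:E * Ih) `^ p^-1)%E).
  apply: gt0_ler_poweR => //; rewrite in_itv/= leey andbT.
    by apply: integral_ge0 => x _; rewrite lee_fin powR_ge0.
  by rewrite mule_ge0// lee_fin ltW.
(* [Kmu m] appears to the power [1 / p], which is at most [Kmu m] because [Kmu m >= 1]. *)
rewrite poweRM ?lee_fin ?(ltW K0)// poweR_EFin lee_wpmul2r ?poweR_ge0//.
rewrite lee_fin -[leRHS]powRr1 ?(ltW K0)//; apply: ler_powR => //.
by rewrite invf_le1// ltW.
Qed.

End LK_bounded.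

(** * Approximation of absolutely continuous functions *)

Section smooth.
Context {R : realType}.
Notation mu := (@lebesgue_measure R).
Local Notation I01 := (`[(0:R), (1:R)]%classic : set R).
Local Notation cell n k := (`[k%:R / n.+1%:R, k.+1%:R / n.+1%:R]%classic : set R).
Variables m p : R.
Hypotheses (m0 : 0 < m) (p1 : 1 < p).
Implicit Types f g h : R -> R.

Lemma abs_cont01_bounded g : abs_cont01 g ->
  exists2 C : R, 0 <= C & forall x, 0 <= x <= 1 -> `|g x| <= C.
Proof.
move=> acg; have bvg := abs_cont01_bounded_variation acg.
have TV01 : total_variation 0 1 g \is a fin_num by apply/bounded_variationP.
exists (`|g 0| + fine (total_variation 0 1 g)).
  by rewrite addr_ge0// fine_ge0// total_variation_ge0.
move=> x /andP[x0 x1]; rewrite -lerBlDl; apply: le_trans (lerB_dist _ _) _.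
rewrite -lee_fin fineK//; apply: le_trans (total_variation_ge _ x0) _.
by rewrite (total_variationD g x0 x1) leeDl// total_variation_ge0.
Qed.

Lemma abs_cont01M g h : abs_cont01 g -> abs_cont01 h ->
  abs_cont01 (fun x => g x * h x).
Proof.
move=> acg ach.
have [C C0 gC] := abs_cont01_bounded acg; have [D D0 hD] := abs_cont01_bounded ach.
move=> e e0; pose K := C + D + 1.
have K0 : 0 < K by rewrite ltr_wpDl// addr_ge0.
have eK : 0 < e / (2 * K) by rewrite divr_gt0// mulr_gt0.
have [d1 d10 H1] := acg _ eK; have [d2 d20 H2] := ach _ eK.
exists (Num.min d1 d2); first by rewrite lt_min d10.
move=> N a b ab01 abdis; rewrite lt_min => /andP[sd1 sd2].
have s1 := H1 N a b ab01 abdis sd1; have s2 := H2 N a b ab01 abdis sd2.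
rewrite (_ : e = K * (e / (2 * K) + e / (2 * K))); last by field; rewrite gt_eqF.
apply: (@le_lt_trans _ _ (K * (\sum_(i < N) `|g (b i) - g (a i)| +
    \sum_(i < N) `|h (b i) - h (a i)|))); last first.
  by rewrite ltr_pM2l// ltrD.
rewrite -big_split/= mulr_sumr; apply: ler_sum => i _.
have [a0 [ab b1]] := ab01 i.
have gb : `|g (b i)| <= C by apply: gC; rewrite b1 (le_trans a0).
have ha : `|h (a i)| <= D by apply: hD; rewrite a0 (le_trans ab).
rewrite (_ : _ - _ = g (b i) * (h (b i) - h (a i)) + h (a i) * (g (b i) - g (a i))); last by ring.
apply: le_trans (ler_normD _ _) _; rewrite !normrM addrC mulrDr.
apply: lerD; apply: ler_wpM2r => //; rewrite /K; lra.
Qed.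

Lemma lipschitz_abs_cont01 g (c : R) :
  (forall x y, 0 <= x -> x <= y -> y <= 1 -> `|g y - g x| <= c * (y - x)) ->
  abs_cont01 g.
Proof.
move=> lipg e e0; have c0 : 0 < `|c| + 1 by rewrite ltr_wpDl.
exists (e / (`|c| + 1)); first by rewrite divr_gt0.
move=> N a b ab01 _; rewrite ltr_pdivlMr// mulrC => sd.
apply: le_lt_trans sd; rewrite mulr_sumr; apply: ler_sum => i _.
have [a0 [ab b1]] := ab01 i; apply: le_trans (lipg _ _ a0 ab b1) _.
by rewrite ler_wpM2r ?subr_ge0// (le_trans (ler_norm _))// lerDl.
Qed.

(** On [[1 + m, 2 + m]] the logarithm is 1-Lipschitz, its argument being at least 1, and bounded
    below by [ln (1 + m)]; so its reciprocal is Lipschitz. *)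
Lemma abs_cont01_lnmuV : abs_cont01 (fun x => (lnmu m x)^-1).
Proof.
have l1 := ln1m_gt0 m0.
apply: (@lipschitz_abs_cont01 _ (ln (1 + m) ^- 2)) => x y x0 xy y1.
have x01 : 0 <= x <= 1 by rewrite x0 (le_trans xy).
have y01 : 0 <= y <= 1 by rewrite y1 (le_trans x0).
have lx := lnmu_gt0 m0 x01; have ly := lnmu_gt0 m0 y01.
have /andP[lx1 _] := lnmu_itv m0 x01; have /andP[ly1 _] := lnmu_itv m0 y01.
have x1 : 1 <= 1 + m + x by have m0' := m0; lra.
have xpos := lt_le_trans ltr01 x1.
have ypos : 0 < 1 + m + y by have m0' := m0; lra.
have dl : 0 <= lnmu m y - lnmu m x <= y - x.
  rewrite /lnmu subr_ge0 ler_ln ?posrE// lerD2l xy/=.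
  rewrite -ln_div ?posrE//.
  rewrite (_ : _ / _ = 1 + (y - x) / (1 + m + x)); last by field; rewrite gt_eqF.
  have yx0 : 0 <= (y - x) / (1 + m + x) by rewrite divr_ge0 ?subr_ge0 ?(ltW xpos).
  apply: le_trans (le_ln1Dx _) _; first exact: lt_le_trans yx0.
  by rewrite ler_pdivrMr// ler_peMr ?subr_ge0.
have /andP[dl0 dl1] := dl.
rewrite (_ : _ - _ = - ((lnmu m y - lnmu m x) / (lnmu m x * lnmu m y))); last first.
  by field; rewrite !gt_eqF.
rewrite normrN ger0_norm ?divr_ge0 ?mulr_ge0 ?(ltW lx) ?(ltW ly)// mulrC.
apply: ler_pM => //; first by rewrite invr_ge0 mulr_ge0// ltW.
rewrite lef_pV2 ?posrE ?mulr_gt0 ?exprn_gt0//.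
by rewrite expr2 ler_pM// ltW.
Qed.

Lemma abs_cont01_fmu g : abs_cont01 g -> abs_cont01 (fmu m g).
Proof. by move=> acg; apply: abs_cont01M => //; exact: abs_cont01_lnmuV. Qed.

Lemma LKD n f g x : inLp p f -> inLp p g ->
  LK m n f x = LK m n (fun x => f x - g x) x + LK m n g x.
Proof.
move=> Lf Lg; have Lfm := inLp_fmu m0 p1 Lf; have Lgm := inLp_fmu m0 p1 Lg.
rewrite /LK -mulrDr -big_split/=; congr (_ * _); apply: eq_bigr => k _.
rewrite -!mulrDr; congr (_ * (_ * _)).
have mc : measurable (cell n k : set (measurableTypeR R)) by exact: measurable_itv.
have if_ := cell_integrable (ltn_ord k) (inLp_integrable p1 Lfm).
have ig := cell_integrable (ltn_ord k) (inLp_integrable p1 Lgm).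
rewrite (_ : fmu m (fun x => f x - g x) = fun t => fmu m f t - fmu m g t); last first.
  by apply/funext => t; rewrite /fmu mulrBl.
by rewrite RintegralB// subrK.
Qed.

(** Bounds the mean of [|t - x|]: the first two terms are those of [sum_bern_dist]; in the last, one
    [1 / n.+1] is the cell width and the other bounds [|a_next m n x - x|]. *)
Definition LK_rate n : R :=
  1 / (2 * Num.sqrt n.+1%:R) + 1 / Num.sqrt n.+1%:R ^+ 3 + 2 / n.+1%:R.

Lemma LK_sub_le n g x M : 0 <= x <= 1 -> inLp p g -> 0 <= M ->
  (forall t, 0 <= t <= 1 -> `|fmu m g t - fmu m g x| <= M * `|t - x|) ->
  `|LK m n g x - g x| <= ln (2 + m) * LK_rate n * M.
Proof.
move=> x01 Lg M0 Mx; have a01 := a_next_itv m0 n x01.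
have Lgm := inLp_fmu m0 p1 Lg; have intg := inLp_integrable p1 Lgm.
have lx := lnmu_gt0 m0 x01; have /andP[_ lx2] := lnmu_itv m0 x01.
have mc k : measurable (cell n k : set (measurableTypeR R)) by exact: measurable_itv.
(* The weights sum to 1, so [g x], as [lnmu m x * fmu m g x], can be moved under the sum and the
   integrals. *)
have -> : LK m n g x - g x = lnmu m x * \sum_(k < n.+1) bern n k (a_next m n x) *
    (n.+1%:R * \int[mu]_(t in cell n k) (fmu m g t - fmu m g x)).
  have gE : g x = lnmu m x * \sum_(k < n.+1) bern n k (a_next m n x) * fmu m g x.
    by rewrite -mulr_suml sum_bern mul1r /fmu mulrCA divff ?mulr1// gt_eqF.
  rewrite [in LHS]gE /LK -mulrBr -sumrB; congr (_ * _); apply: eq_bigr => k _.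
  rewrite -mulrBr; congr (_ * _).
  rewrite RintegralB//; last 2 first.
    - exact: cell_integrable intg.
    - exact: integrable_cell_cst.
  by rewrite Rintegral_cell_cst; field; rewrite addrC natr1 pnatr_eq0.
rewrite normrM (ger0_norm (ltW lx)) -mulrA; apply: ler_pM => //; first exact: ltW.
apply: le_trans (ler_norm_sum _ _ _) _.
have kx (k : 'I_n.+1) : `|bern n k (a_next m n x) *
    (n.+1%:R * \int[mu]_(t in cell n k) (fmu m g t - fmu m g x))| <=
    M * (bern n k (a_next m n x) * `|k%:R / n.+1%:R - a_next m n x| +
       bern n k (a_next m n x) * (2 / n.+1%:R)).
  rewrite normrM (ger0_norm (bern_ge0 _ _ a01)) -mulrDr mulrCA.
  apply: ler_wpM2l; first exact: bern_ge0.
  rewrite normrM ger0_norm// mulrC -ler_pdivlMr//.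
  have idiff : mu.-integrable (cell n k) (EFin \o (fun t => fmu m g t - fmu m g x)).
    exact: (integrableB (mc k) (cell_integrable (ltn_ord k) intg)
      (integrable_cell_cst n k (fmu m g x))).
  apply: le_trans (le_normr_Rintegral (mc k) idiff) _.
  rewrite -[leRHS](Rintegral_cell_cst n k); apply: le_Rintegral => //.
  - exact: integrable_norm.
  - exact: integrable_cell_cst.
  move=> t tk; have := cell_sub01 (ltn_ord k) tk; rewrite /= in_itv/= => t01.
  apply: le_trans (Mx t t01) _; apply: ler_wpM2l => //.
  have := a_next_dist m0 n x01; set y := a_next m n x => yx.
  have tk1 : `|t - k%:R / n.+1%:R| <= 1 / n.+1%:R.
    move: tk; rewrite /= in_itv/= => /andP[kt tk].
    rewrite ger0_norm ?subr_ge0// lerBlDl -mulrDl.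
    by rewrite natr1.
  rewrite (_ : t - x = (t - k%:R / n.+1%:R) + ((k%:R / n.+1%:R - y) + (y - x))); last by ring.
  apply: le_trans (ler_normD _ _) _.
  have := ler_normD (k%:R / n.+1%:R - y) (y - x).
  move: tk1 yx; rewrite (_ : 2 / n.+1%:R = 1 / n.+1%:R + 1 / n.+1%:R); last by rewrite -mulrDl.
  by move=> H1 H2 H3; apply: le_trans (lerD H1 H3) _; rewrite addrCA !lerD2l.
apply: le_trans; first by apply: ler_sum => k _; exact: kx.
rewrite -mulr_sumr big_split/= -mulr_suml sum_bern mul1r mulrC ler_wpM2r// lerD2r.
exact: sum_bern_dist.
Qed.

End smooth.

(** * Rate of approximation on the Sobolev space *)

Section rate.
Context {R : realType}.
Notation mu := (@lebesgue_measure R).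
Local Notation I01 := (`[(0:R), (1:R)]%classic : set R).
Variables m p : R.
Hypotheses (m0 : 0 < m) (p1 : 1 < p).
Implicit Types f g h : R -> R.

(** The quotient rule for [g / lnmu m], written out so that measurability and Lp bounds follow at
    once from those of [g] and [derive1 g]. *)
Definition dfmu g x : R :=
  derive1 g x / lnmu m x - g x * (lnmu m x ^- 2 * (1 + m + x)^-1).

Lemma derive1_fmu g x : 0 < x < 1 -> derivable g x 1 ->
  derive1 (fmu m g) x = dfmu g x.
Proof.
move=> /andP[x0 x1] dg.
have x01 : 0 <= x <= 1 by rewrite !ltW.
have xpos : 0 < 1 + m + x by have m0' := m0; lra.
have lx := lnmu_gt0 m0 x01.
have dlin : is_derive x 1 (fun z : R => 1 + m + z) 1.
  have := is_deriveD (is_derive_cst (1 + m) x 1) (is_derive_id x 1).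
  by rewrite add0r.
have dln : is_derive x 1 (lnmu m) ((1 + m + x)^-1 * 1).
  exact: (@is_derive1_comp R (@ln R) (fun z => 1 + m + z) x _ _ (is_derive1_ln xpos) dlin).
have dV := is_deriveV (lt0r_neq0 lx) dln.
have dg' : is_derive x 1 g (derive1 g x).
  by apply: DeriveDef; [exact: dg|rewrite derive1E].
have dM := is_deriveM dg' dV.
rewrite derive1E; have [_ ->] := dM.
rewrite /dfmu mulr1 /GRing.scale/=; ring.
Qed.

Lemma measurable_dfmu g : measurable_fun I01 g -> measurable_fun I01 (derive1 g) ->
  measurable_fun I01 (dfmu g).
Proof.
move=> mg mdg; have m0' := m0; have mV := measurable_lnmuV m0.
have mI : measurable_fun I01 (fun x : R => (1 + m + x)^-1).
  apply: subspace_continuous_measurable_fun; first exact: measurable_itv.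
  apply: continuous_in_subspaceT => x; rewrite inE/= in_itv/= => /andP[x0 x1].
  apply: cvgV; first by rewrite gt_eqF//; lra.
  by apply: cvgD; [exact: cvg_cst|exact: cvg_id].
apply: measurable_funB; first exact: measurable_funM.
apply: measurable_funM => //; apply: measurable_funM => //.
rewrite (_ : (fun x => lnmu m x ^- 2) = (fun x => (lnmu m x)^-1 ^+ 2)); last first.
  by apply/funext => x; rewrite exprVn.
exact: measurable_funX.
Qed.

Lemma ln2m_ge : 1 / 2 <= ln (2 + m).
Proof.
apply: (@le_trans _ _ (ln (1 + 1))).
  by have := @ln1D_ge_div R 1 ler01; rewrite div1r.
by have m0' := m0; rewrite ler_ln ?posrE//; lra.
Qed.

Let rho := ln (2 + m) / ln (1 + m).

Lemma inLp_pnorm_dfmu g : abs_cont01 g -> inLp p (derive1 g) ->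
  inLp p (dfmu g) /\
  (pnorm p (dfmu g) <= (2 * rho / ln (1 + m))%:E * W1p_norm p g)%E.
Proof.
move=> acg Ldg; have m0' := m0; have [mdg _] := Ldg.
have mg := abs_cont01_measurable acg.
have [C C0 gC] := abs_cont01_bounded acg; have Lg := bounded_inLp p1 mg gC.
have l1 := ln1m_gt0 m0; have l2 := ln2m_gt0 m0; have l2' := ln2m_ge.
have rho0 : 0 < rho by rewrite divr_gt0.
(* One constant for both terms of the quotient rule: [2 * rho >= 1] serves the one with [derive1 g],
   and [2 * ln (2 + m) >= 1] the one with [g]. *)
pose k := 2 * rho / ln (1 + m).
have k0 : 0 < k by rewrite divr_gt0// mulr_gt0.
have mV := measurable_lnmuV m0.
pose u x := derive1 g x / lnmu m x.
pose v x := - (g x * (lnmu m x ^- 2 * (1 + m + x)^-1)).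
have mu_ : measurable_fun I01 u by exact: measurable_funM.
have mdf := measurable_dfmu mg mdg.
have mv : measurable_fun I01 v.
  rewrite (_ : v = fun x => dfmu g x - u x); last first.
    by apply/funext => x; rewrite /dfmu /u addrC addKr.
  exact: measurable_funB.
have Vle x : 0 <= x <= 1 -> 0 <= (lnmu m x)^-1 <= (ln (1 + m))^-1.
  move=> x01; have lx := lnmu_gt0 m0 x01; have /andP[lx1 _] := lnmu_itv m0 x01.
  by rewrite invr_ge0 (ltW lx)/= lef_pV2.
have rho1 : 1 <= 2 * rho.
  rewrite /rho mulrA ler_pdivlMr// mul1r.
  have : ln (1 + m) <= ln (2 + m) by rewrite ler_ln ?posrE; lra.
  by lra.
have kE : (ln (1 + m))^-1 <= k.
  by rewrite /k ler_peMl// invr_ge0 ltW.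
have up : (pnorm p u <= k%:E * pnorm p (derive1 g))%E.
  apply: pnorm_le => // x x01; rewrite /u normrM mulrC ler_wpM2r//.
  by have /andP[V0 V1] := Vle _ x01; rewrite ger0_norm// (le_trans V1).
have vp : (pnorm p v <= k%:E * pnorm p g)%E.
  apply: pnorm_le => // x x01; rewrite /v normrN normrM mulrC ler_wpM2r//.
  have /andP[V0 V1] := Vle _ x01; have /andP[x0 x1] := x01.
  have I0 : 0 < 1 + m + x by lra.
  rewrite -exprVn ger0_norm; last by rewrite mulr_ge0 ?exprn_ge0// invr_ge0 ltW.
  apply: (@le_trans _ _ ((ln (1 + m))^-1 ^+ 2 * 1)).
    apply: ler_pM; rewrite ?exprn_ge0// ?invr_ge0 ?(ltW I0)//.
      by rewrite lerXn2r// nnegrE// invr_ge0 ltW.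
    by rewrite invf_le1//; lra.
  rewrite mulr1 expr2 /k ler_wpM2r ?invr_ge0 ?(ltW l1)//.
  rewrite /rho mulrA ler_peMl ?invr_ge0 ?(ltW l1)//; lra.
have dE : dfmu g = (fun x => u x + v x)%R by apply/funext.
have dle : (pnorm p (dfmu g) <= k%:E * W1p_norm p g)%E.
  rewrite dE; apply: le_trans (pnormD p1 mu_ mv) _.
  rewrite /W1p_norm ge0_muleDr ?pnorm_ge0// addeC.
  exact: (leeD vp up).
split; last exact: dle.
apply/(inLpE p1) => //; apply: le_lt_trans dle _.
rewrite lte_mul_pinfty ?lee_fin ?(ltW k0)// /W1p_norm lte_add_pinfty//.
  exact/(inLpE p1 mg).
exact/(inLpE p1 mdg).
Qed.

(** For positive [t] the maximal function dominates the mean of [|dfmu g|] between [x] and [t]. The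
    supremum leaves out [t = 0], which is reached by continuity from a small [s > 0]. *)
Lemma fmu_lipschitz_maxfun g x M : abs_cont01 g -> measurable_fun I01 (derive1 g) ->
  0 <= x <= 1 -> maxfun (dfmu g) x = M%:E -> 0 <= M ->
  forall t, 0 <= t <= 1 -> `|fmu m g t - fmu m g x| <= M * `|t - x|.
Proof.
move=> acg mdg x01 maxE M0; have /andP[x0 x1] := x01.
have acf := abs_cont01_fmu m0 acg.
have mdf := measurable_dfmu (abs_cont01_measurable acg) mdg.
have df : {ae mu, forall x, 0 < x < 1 -> derive1 (fmu m g) x = dfmu g x}.
  have := abs_cont01_ae_derivable acg.
  apply: filterS; first exact: (ae_filter_ringOfSetsType mu).
  by move=> y dg y01; apply: derive1_fmu => //; exact: dg.
have pos t : 0 < t <= 1 -> `|fmu m g t - fmu m g x| <= M * `|t - x|.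
  move=> /andP[t0 t1]; have [->|tx] := eqVneq t x; first by rewrite !subrr normr0 mulr0.
  have tx0 : 0 < `|t - x| by rewrite normr_gt0 subr_eq0.
  have : ((`|t - x|)^-1%:E * \int[mu]_(u in `[Order.min x t, Order.max x t])
      (`|dfmu g u|)%:E <= M%:E)%E.
    by rewrite -maxE; apply: ereal_sup_ubound; exists t => //=; rewrite t0.
  rewrite lee_pdivrMl// -EFinM mulrC -lee_fin; apply: le_trans.
  have [xt|tx'] := leP x t.
    exact: (abs_cont01_le_integral acf mdf df).
  by rewrite distrC; apply: (abs_cont01_le_integral acf mdf df) => //; exact: ltW.
move=> t /andP[]; rewrite le_eqVlt => /predU1P[<- _|t0 t1]; last by apply: pos; rewrite t0.
rewrite sub0r normrN (ger0_norm x0).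
apply/ler_addgt0Pr => e e0.
have e20 : 0 < e / 2 by rewrite divr_gt0.
have [d d0 H] := abs_cont01_uniform acf e20.
(* [s] must lie within the modulus of continuity, be at most 1, and make [M * s] at most [e / 2];
   since [M] may be 0, the divisor is [M + 1]. *)
pose K := M + 1; have K0 : 0 < K by rewrite ltr_wpDl.
pose s := Num.min (d / 2) (Num.min 1 (e / 2 / K)).
have s0 : 0 < s by rewrite /s !lt_min ltr01 (divr_gt0 d0)//= divr_gt0.
have s1 : s <= 1 by rewrite !ge_min lexx orbT.
have sd : s <= d / 2 by rewrite ge_min lexx.
have se : s <= e / 2 / K by rewrite !ge_min lexx !orbT.
have h1 : `|fmu m g 0 - fmu m g s| < e / 2.
  apply: H; rewrite ?lexx ?ler01 ?(ltW s0)//.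
  by rewrite sub0r normrN gtr0_norm//; lra.
have h2 : `|fmu m g s - fmu m g x| <= M * `|s - x| by apply: pos; rewrite s0.
have h3 : `|s - x| <= s + x.
  by apply: le_trans (ler_normB _ _) _; rewrite (gtr0_norm s0) (ger0_norm x0).
have h4 : M * s <= e / 2.
  apply: (@le_trans _ _ (K * s)); first by rewrite ler_wpM2r ?lerDl// ltW.
  by rewrite mulrC -ler_pdivlMr.
have h5 := ler_wpM2l M0 h3.
have h6 := ler_distD (fmu m g s) (fmu m g 0) (fmu m g x).
rewrite mulrDr in h5; lra.
Qed.

Lemma pnorm_LK_sub_le Cp n g : maximal_const p Cp -> W1p p g ->
  (pnorm p (fun x => LK m n g x - g x)%R <=
   (2 * rho ^+ 2 * LK_rate n * Cp)%:E * W1p_norm p g)%E.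
Proof.
move=> [Cp0 maxC] [acg Ldg]; have [mdg _] := Ldg.
have [Ld dle] := inLp_pnorm_dfmu acg Ldg.
have mg := abs_cont01_measurable acg.
have [C C0 gC] := abs_cont01_bounded acg; have Lg := bounded_inLp p1 mg gC.
have l1 := ln1m_gt0 m0; have l2 := ln2m_gt0 m0.
have s0 : (0 : R) < Num.sqrt n.+1%:R by rewrite sqrtr_gt0.
have Z0 : 0 < LK_rate n :> R.
  by rewrite /LK_rate !addr_gt0// divr_gt0// ?mulr_gt0// exprn_gt0.
have c0 : 0 < ln (2 + m) * LK_rate n by rewrite mulr_gt0.
apply: (@le_trans _ _ ((ln (2 + m) * LK_rate n)%:E * Lpnorm01 p (maxfun (dfmu g)))%E).
  apply: pnorm_le_Lpnorm01 => //.
    by apply: measurable_funB => //; apply: measurable_funTS; apply: measurable_LK.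
  move=> x x01; have max0 : (0 <= maxfun (dfmu g) x)%E.
    (* Nonnegativity of the supremum rests on its index set being nonempty. *)
    have [t [t01 tx]] : exists t : R, 0 < t <= 1 /\ t != x.
      have [->|x1] := eqVneq x 1; last by exists 1; rewrite ltr01 lexx eq_sym.
      by exists (1 / 2); split; [apply/andP; split; lra|apply/negP => /eqP; lra].
    apply: ereal_sup_ge; eexists; first by exists t => //=; split.
    by apply: mule_ge0; [rewrite lee_fin invr_ge0|exact: integral_ge0].
  rewrite gee0_abs//; case maxE : (maxfun (dfmu g) x) => [M| |]; last by rewrite maxE in max0.
  - rewrite -EFinM lee_fin; have M0 : 0 <= M by rewrite -lee_fin -maxE.
    apply: (LK_sub_le m0 p1) => //.
    exact: fmu_lipschitz_maxfun.
  (* Where the maximal function is infinite the bound is trivial, its coefficient being positive. *)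
  - by rewrite gt0_muley ?leey// lte_fin.
apply: (@le_trans _ _ ((ln (2 + m) * LK_rate n)%:E * (Cp%:E * pnorm p (dfmu g)))%E).
  by apply: lee_wpmul2l; [rewrite lee_fin ltW|exact: maxC].
rewrite (_ : 2 * _ * _ * _ = ln (2 + m) * LK_rate n * Cp * (2 * rho / ln (1 + m))); last first.
  by rewrite /rho; field; rewrite gt_eqF.
rewrite muleA -EFinM (EFinM (_ * Cp)) -muleA; apply: lee_wpmul2l => //.
by rewrite lee_fin mulr_ge0// ltW.
Qed.

(** With [w] the inverse of the square root of [n.+1], the left side is
    [w + 2 * w ^+ 3 + 4 * w ^+ 2], and [T_n] contains at least [7 / 5 * w]. The surplus [2 / 5 * w]
    pays for the higher powers once [w <= 1 / 14], which holds since [14 ^+ 2 = 196 <= 200]. *)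
Lemma LK_rate_le n : (199 <= n)%N -> 2 * LK_rate n <= T_n m n :> R.
Proof.
move=> n199; have g0 := gamma_n_ge0 m0 n.
set s : R := Num.sqrt n.+1%:R.
have s0 : 0 < s by rewrite sqrtr_gt0.
have s2 : s ^+ 2 = n.+1%:R by rewrite sqr_sqrtr.
have s14 : 14 <= s.
  rewrite -(@ler_pXn2r _ 2)// ?nnegrE ?(ltW s0)// s2 -natrX ler_nat.
  by apply: (@leq_trans 199) => //; exact: leqW.
have q2 : 7 / 5 <= Num.sqrt 2 :> R.
  rewrite -(@ler_pXn2r _ 2)// ?nnegrE ?sqrtr_ge0//.
  by rewrite sqr_sqrtr//; lra.
rewrite /T_n /LK_rate -/s -s2.
set w := s^-1.
have w0 : 0 < w by rewrite invr_gt0.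
have w14 : w <= 14^-1 by rewrite lef_pV2 ?posrE.
have -> : 1 / (2 * s) + 1 / s ^+ 3 + 2 / s ^+ 2 = w / 2 + w ^+ 3 + 2 * w ^+ 2.
  by rewrite /w; field; rewrite gt_eqF.
have -> : 1 / (2 * s ^+ 2) = w ^+ 2 / 2 by rewrite /w; field; rewrite gt_eqF.
rewrite -/w; have q2w : 7 / 5 * w <= Num.sqrt 2 * w by rewrite ler_wpM2r// ltW.
have w2 : w ^+ 2 <= w / 14 by rewrite expr2 ler_wpM2l ?(ltW w0).
have w3 : w ^+ 3 <= w / 196.
  by rewrite exprS; apply: ler_wpM2l; [exact: ltW|lra].
have w20 : 0 <= w ^+ 2 by rewrite sqr_ge0.
lra.
Qed.

End rate.

Theorem theorem6p3 (R : realType) (m p Cp : R) (f : R -> R) :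
  0 < m -> 1 < p -> maximal_const p Cp -> inLp p f ->
  exists N : nat, forall n : nat, (N <= n)%N ->
    (pnorm p (fun x => LK m n f x - f x)%R
      <= ((ln (2 + m) / ln (1 + m)) * (Kmu m + 1))%:E * Kfun p f (Gamma_n p Cp m n))%E.
Proof.
move=> m0 p1 maxC Lf; exists 199 => n n199; have [mf _] := Lf.
have l1 := ln1m_gt0 m0; have l2 := ln2m_gt0 m0.
set rho := ln (2 + m) / ln (1 + m).
have rho1 : 1 <= rho.
  by rewrite /rho ler_pdivlMr// mul1r ler_ln ?posrE; lra.
have rho0 : 0 < rho := lt_le_trans ltr01 rho1.
have K0 : 0 < Kmu m by rewrite addr_gt0// divr_gt0// addr_gt0.
have K10 : 0 < Kmu m + 1 by rewrite addr_gt0.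
have c0 : 0 < rho * (Kmu m + 1) by rewrite mulr_gt0.
have [Cp0 _] := maxC.
have T0 : 0 <= T_n m n.
  apply: le_trans (LK_rate_le m0 n199); rewrite mulr_ge0// /LK_rate.
  by rewrite !addr_ge0// divr_ge0// ?mulr_ge0// ?exprn_ge0 ?sqrtr_ge0.
rewrite -lee_pdivrMl//; apply/ereal_infP => _ [g Wg <-]; rewrite lee_pdivrMl//.
have [acg Ldg] := Wg; have mg := abs_cont01_measurable acg.
have [C C0 gC] := abs_cont01_bounded acg; have Lg := bounded_inLp p1 mg gC.
have Lfg := inLpB p1 Lf Lg; have [mfg _] := Lfg.
have mLK h : measurable_fun (`[(0 : R), (1 : R)]%classic : set R) (LK m n h).
  by apply: measurable_funTS; apply: measurable_LK.
have Wg0 : (0 <= W1p_norm p g)%E by rewrite /W1p_norm adde_ge0// pnorm_ge0.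
have -> : (fun x => LK m n f x - f x) = (fun x => (LK m n (fun x => f x - g x) x +
    (LK m n g x - g x)) + - (f x - g x)).
  by apply/funext => x; rewrite (LKD m0 p1 n x Lf Lg); ring.
apply: (@le_trans _ _ ((rho * Kmu m)%:E * pnorm p (fun x => f x - g x)%R +
   (2 * rho ^+ 2 * LK_rate n * Cp)%:E * W1p_norm p g + 1%:E * pnorm p (fun x => f x - g x)%R)%E).
  apply: le_trans (pnormD p1 _ _) _.
  - by apply: measurable_funD => //; exact: measurable_funB.
  - exact: measurableT_comp.
  apply: leeD; last by apply: pnorm_le => //; [exact: measurableT_comp|move=> x _; rewrite normrN mul1r].
  apply: le_trans (pnormD p1 _ _) _ => //; first exact: measurable_funB.
  by apply: leeD; [exact: pnorm_LK_le|exact: pnorm_LK_sub_le].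
have rK0 : 0 <= rho * Kmu m by apply: mulr_ge0; exact: ltW.
rewrite addeAC -ge0_muleDl ?lee_fin//.
have G0 : 0 <= Gamma_n p Cp m n.
  rewrite /Gamma_n -/rho; apply: mulr_ge0 => //; apply: mulr_ge0; last first.
    by rewrite invr_ge0 ltW.
  apply: mulr_ge0; last exact: ltW.
  by apply: mulr_ge0; [exact: powR_ge0|rewrite le_max (ltW Cp0) orbT].
rewrite [leRHS]ge0_muleDr ?pnorm_ge0 ?mule_ge0 ?lee_fin//.
apply: leeD.
  apply: lee_wpmul2r; first exact: pnorm_ge0.
  (* The coefficient 1 of [g - f] is absorbed by [1 <= rho]. *)
  by rewrite (mulrDr rho (Kmu m) 1) mulr1 EFinD leeD2l// lee_fin.
rewrite muleA -EFinM; apply: lee_wpmul2r => //; rewrite lee_fin /Gamma_n -/rho.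
(* The factor [Kmu m + 1] cancels its inverse in [Gamma_n]. The rest is compared factor by factor: 1
   with the power of 2, [Cp] with [Cpmu p Cp m], [2 * LK_rate n] with [T_n m n]. *)
rewrite (_ : rho * (Kmu m + 1) * _ = rho ^+ 2 * (powR 2 ((p - 1) / p) * (Cpmu p Cp m * T_n m n))); last first.
  by field; rewrite gt_eqF.
rewrite (_ : 2 * _ * _ * _ = rho ^+ 2 * (1 * (Cp * (2 * LK_rate n)))); last by ring.
have Z0 : 0 <= 2 * LK_rate n :> R.
  by rewrite mulr_ge0// !addr_ge0// divr_ge0// ?mulr_ge0// ?exprn_ge0 ?sqrtr_ge0.
apply: ler_wpM2l; first exact: sqr_ge0.
apply: ler_pM => //; first by rewrite mulr_ge0// ltW.
  rewrite -[leLHS](powRr0 2); apply: ler_powR; first by rewrite ler1n.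
  by rewrite divr_ge0; lra.
apply: ler_pM => //; [exact: ltW|by rewrite le_max lexx orbT|exact: LK_rate_le].
Qed.
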